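(* Let $L>0$, $\alpha>0$ and $\omega>0$ be fixed. Let $\varphi$ be an even, positive, $L$-periodic real solution (with minimal period $L$) of $$-\varphi''+\omega\varphi-|\varphi|^\alpha\varphi=0$$ obtained from the minimization problem $$\inf\left\{\mathcal{B}_\omega(u):=\frac12\int_0^L |u_x|^2+\omega|u|^2\,dx \;:\; u\in\mathbb{H}^1_{per,even},\ \int_0^L|u|^{\alpha+2}\,dx=\tau\right\}$$ for some $\tau>0$ (in the sense made precise in the context). Then there exist $\lambda>0$, $\kappa>0$ and ${\rm w}\in\mathbb{H}^2_{per}$, ${\rm w}\neq 0$, such that $$\mathcal{S}(\kappa){\rm w}=\lambda J{\rm w}.$$ In other words, the standing wave $\varphi$ is transversally unstable.
   Context: Functions on the torus $\mathbb{T}_L$ are identified with $L$-periodic functions on $\mathbb{R}$. $H^s_{per}=H^s(\mathbb{T}_L)$ is the Sobolev space of real-valued $L$-periodic functions, $L^2_{per}=H^0_{per}$, $\mathbb{H}^s_{per}=H^s_{per}\times H^s_{per}$, $\mathbb{L}^2_{per}=L^2_{per}\times L^2_{per}$; a complex-valued function $f=f_1+if_2$ is identified with the pair $(f_1,f_2)$, and $|u|$ is the complex modulus. $\mathbb{H}^1_{per,even}$ is the subspace of $\mathbb{H}^1_{per}$ of even functions. The phrase ''$\varphi$ is obtained from the minimization problem'' means: $\varphi$ is the real function such that, for some $\theta_0\in\mathbb{R}$, $\Phi=e^{i\theta_0}\varphi$ is a minimizer of the problem for some $\tau>0$ (equivalently $\tau=\int_0^L|\varphi|^{\alpha+2}dx$),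 normalized by scaling so that the Lagrange multiplier is $1$, i.e. so that $-\Phi''+\omega\Phi-|\Phi|^\alpha\Phi=0$. Operators with domain $H^2_{per}\subset L^2_{per}$: $$\mathcal{L}_1=-\partial_x^2+\omega-(\alpha+1)|\varphi|^\alpha,\qquad \mathcal{L}_2=-\partial_x^2+\omega-|\varphi|^\alpha .$$ Set $J=\begin{pmatrix}0&-1\\1&0\end{pmatrix}$ and, for $\kappa\in\mathbb{R}$, the operator on $\mathbb{L}^2_{per}$ with domain $\mathbb{H}^2_{per}$ $$\mathcal{S}(\kappa)=J^{-1}\begin{pmatrix}\mathcal{L}_1+\kappa^2&0\\0&\mathcal{L}_2+\kappa^2\end{pmatrix}J=\begin{pmatrix}\mathcal{L}_2+\kappa^2&0\\0&\mathcal{L}_1+\kappa^2\end{pmatrix}.$$ These arise from linearizing $iu_t+\Delta u+|u|^\alpha u=0$ on $\mathbb{T}_L\times\mathbb{R}$ about the standing wave $e^{i\omega t}\varphi(x)$ with perturbations of the form $e^{\lambda t}\cos(\kappa y){\rm v}(x)$. The wave $\varphi$ is called transversally unstable if for some $\kappa>0$ there are $\lambda\in\mathbb{C}$ with ${\rm Re}(\lambda)>0$ and $U\neq0$ (in the complexification of $\mathbb{H}^2_{per}$) with $\mathcal{S}(\kappa)U=\lambda JU$. *)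

(* Defs.v *)
From mathcomp Require Import all_boot all_order all_algebra.
From mathcomp Require Import all_classical all_reals all_analysis.
From mathcomp Require Import complex.
Set Implicit Arguments.
Unset Strict Implicit.
Unset Printing Implicit Defensive.
Import Order.TTheory GRing.Theory Num.Theory.
Import numFieldNormedType.Exports.
Local Open Scope classical_set_scope.
Local Open Scope ring_scope.

(* Elements of L^2_per and H^s_per are represented by measurable functions on
   the whole line that are L-periodic at every point; equality of classes is
   equality almost everywhere. Complex-valued functions are pairs
   (real part, imaginary part) of real functions. *)

Section Sobolev.
Context {R : realType}.
Implicit Types (L : R) (f g : R -> R) (u v : (R -> R) * (R -> R)).

Local Notation mu := (@lebesgue_measure R).

Definition per_int L f : R := \int[mu]_(x in `[0, L]) f x.

Definition L2per L f : Prop :=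
  [/\ periodic f L, measurable_fun setT f &
      mu.-integrable `[0, L] (fun x => (f x ^+ 2)%:E)].

(* C^oo functions on the torus *)
Definition test_fun L f : Prop :=
  periodic f L /\ forall (n : nat) (x : R), derivable (derive1n n f) x 1.

(* [g] is a weak derivative of [f] in L^2_per; it is unique up to a.e.
   equality. *)
Definition weak_deriv L f g : Prop :=
  [/\ L2per L f, L2per L g &
      forall psi, test_fun L psi ->
        per_int L (fun x => f x * derive1 psi x) =
        - per_int L (fun x => g x * psi x)].

Definition weak_deriv2 L f h : Prop :=
  exists2 g, weak_deriv L f g & weak_deriv L g h.

Definition H1per L f : Prop := exists g, weak_deriv L f g.
Definition H2per L f : Prop := exists h, weak_deriv2 L f h.

Definition HH1per L u : Prop := H1per L u.1 /\ H1per L u.2.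
Definition HH2per L u : Prop := H2per L u.1 /\ H2per L u.2.

(* A class that is a.e. even has an L-periodic representative that is even
   everywhere, so requiring evenness at every point loses no class. *)
Definition HH1per_even L u : Prop :=
  HH1per L u /\ forall x, u.1 (- x) = u.1 x /\ u.2 (- x) = u.2 x.

Definition vweak_deriv L u v : Prop :=
  weak_deriv L u.1 v.1 /\ weak_deriv L u.2 v.2.
Definition vweak_deriv2 L u v : Prop :=
  weak_deriv2 L u.1 v.1 /\ weak_deriv2 L u.2 v.2.

Definition ae_eq2 u v : Prop :=
  {ae mu, forall x, u.1 x = v.1 x /\ u.2 x = v.2 x}.

Definition modulus u (x : R) : R := Num.sqrt (u.1 x ^+ 2 + u.2 x ^+ 2).

End Sobolev.

Section Minimization.
Context {R : realType}.
Implicit Types (L alpha omega tau : R) (phi : R -> R)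
  (u du : (R -> R) * (R -> R)).

(* The value of B_omega at [u], where [du] is the weak derivative of [u]. *)
Definition B_omega L omega u du : R :=
  2^-1 * per_int L (fun x => modulus du x ^+ 2 + omega * modulus u x ^+ 2).

Definition admissible L alpha tau u : Prop :=
  HH1per_even L u /\ per_int L (fun x => modulus u x `^ (alpha + 2)) = tau.

Definition is_minimizer L alpha omega tau u : Prop :=
  admissible L alpha tau u /\
  forall du v dv, vweak_deriv L u du -> vweak_deriv L v dv ->
    admissible L alpha tau v -> B_omega L omega u du <= B_omega L omega v dv.

(* e^{i theta} phi *)
Definition rotate (theta : R) phi : (R -> R) * (R -> R) :=
  (fun x => cos theta * phi x, fun x => sin theta * phi x).

(* The normalization of the Lagrange multiplier to 1 is the equation
   [stationary] below. *)
Definition from_minimization L alpha omega phi : Prop :=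
  exists theta0 tau : R,
    0 < tau /\ is_minimizer L alpha omega tau (rotate theta0 phi).

Definition stationary alpha omega phi : Prop :=
  forall x, [/\ derivable phi x 1, derivable (derive1 phi) x 1 &
    - derive1n 2 phi x + omega * phi x - `|phi x| `^ alpha * phi x = 0].

Definition minimal_period phi L : Prop :=
  [/\ 0 < L, periodic phi L & forall T, 0 < T -> T < L -> ~ periodic phi T].

End Minimization.

Section Linearization.
Context {R : realType}.
Variables (L alpha omega : R) (phi : R -> R).
Implicit Types (kappa : R) (u d2u f : R -> R) (w d2w F : (R -> R) * (R -> R)).

(* The differential expressions take the function and its weak second
   derivative. *)
Definition calL1 u d2u : R -> R := fun x =>
  - d2u x + omega * u x - (alpha + 1) * `|phi x| `^ alpha * u x.

Definition calL2 u d2u : R -> R := fun x =>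
  - d2u x + omega * u x - `|phi x| `^ alpha * u x.

Definition calS kappa w d2w : (R -> R) * (R -> R) :=
  (fun x => calL2 w.1 d2w.1 x + kappa ^+ 2 * w.1 x,
   fun x => calL1 w.2 d2w.2 x + kappa ^+ 2 * w.2 x).

(* The graph of the operator S(kappa) with domain HH^2_per:
   w is in HH^2_per and S(kappa) w = F in LL^2_per. *)
Definition S_graph kappa w F : Prop :=
  exists2 d2w, vweak_deriv2 L w d2w & ae_eq2 (calS kappa w d2w) F.

Definition J w : (R -> R) * (R -> R) := (- w.2, w.1).

(* An element of the complexification of HH^2_per is U = Ur + i Ui; the two
   equations are the real and imaginary parts of S(kappa) U = lambda J U. *)
Definition transversally_unstable : Prop :=
  exists (kappa : R) (lambda : R[i]) (Ur Ui : (R -> R) * (R -> R)),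
    [/\ 0 < kappa, 0 < complex.Re lambda, HH2per L Ur /\ HH2per L Ui,
        ~ (ae_eq2 Ur 0 /\ ae_eq2 Ui 0) &
        S_graph kappa Ur
          (complex.Re lambda *: J Ur - complex.Im lambda *: J Ui) /\
        S_graph kappa Ui
          (complex.Re lambda *: J Ui + complex.Im lambda *: J Ur)].

End Linearization.

(* Main.v *)
Require Import Defs.
From mathcomp Require Import all_boot all_order all_algebra.
From mathcomp Require Import all_classical all_reals all_analysis.
From mathcomp Require Import measurable_realfun complex ring lra.
Import Order.TTheory GRing.Theory Num.Theory.
Import numFieldNormedType.Exports.
Local Open Scope classical_set_scope.
Local Open Scope ring_scope.

(** Write [q = phi `^ alpha], [mu = kappa ^+ 2] and [l = L / 2].  The equation
    [S(kappa) w = lambda J w] is the system of ordinary differential equations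
      [w1'' = (omega - q + mu) w1 + lambda w2],
      [w2'' = (omega - (alpha + 1) q + mu) w2 - lambda w1],
    whose coefficients are even and [L]-periodic.  A solution with
    [w1' = w2' = 0] at [0] and at [l] is symmetric about both points, by
    uniqueness for the Cauchy problem, hence [L]-periodic
    ([coupled_neumann_periodic]).  So instability is a shooting problem on the
    half period: with [A], [B] the solutions having Cauchy data [(1, 0, 0, 0)]
    and [(0, 0, 1, 0)] in the variables [(w1, w1', w2, w2')], a mode exists as
    soon as the 2 x 2 determinant [D(lambda, mu)] of the derivatives of [A]
    and [B] at [l] vanishes.

    At [lambda = 0] the system decouples, and [D(0, mu)] is the product of the
    Neumann data at [l] of two scalar Hill equations, those of [L2 + mu] and
    [L1 + mu].  Everything about them comes from comparing with [phi], which is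
    positive, solves [L2 phi = 0] and has zero derivative at [0] and [l].
    The Wronskian with [phi] shows that the factor of [L2 + mu] is positive for
    all [mu > 0] and that of [L1 + mu] is positive for large [mu]
    ([hill_growth]).  The latter is negative for some [mu1 > 0]
    ([hill_neumann_negative]): follow the even solution of [L1 + mu] from a
    large [mu] downwards as long as it stays positive.  It either survives until
    [mu = 0], where [L1 phi = - alpha q phi < 0] forces a negative slope at [l]
    ([hill_decay]), or develops a first zero, which can only be at [l], again
    with a negative slope ([hill_nonneg_zero]).

    Hence [D(0, mu1) < 0 < D(0, mu2)].  Joining the two points by the arc
    [lambda = t (1 - t)], [mu = (1 - t) mu1 + t mu2], which leaves the axis
    [lambda = 0] immediately, the intermediate value theorem gives a zero of
    [D] with [lambda > 0] and [mu > 0] ([coupled_neumann_exists]).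

    The argument needs existence, uniqueness and Lipschitz dependence on the
    coefficients for linear systems: Picard iteration with the weight
    [expR (K * `|x|)] ([lin_sol_exists]) and a Gronwall estimate
    ([lin_energy], [lin_sol_lipschitz]). *)

(** * Calculus on the line *)

Section Calculus.
Context {R : realType}.
Implicit Types (f g df F : R -> R) (a b c x y : R).
Local Notation mu := (@lebesgue_measure R).

Lemma is_derive_continuous f x c : is_derive x 1 f c -> {for x, continuous f}.
Proof. by move=> fx; apply/differentiable_continuous/derivable1_diffP. Qed.

Lemma le_of_is_derive f df a b : a <= b ->
  (forall x, a <= x <= b -> is_derive x 1 f (df x)) ->
  (forall x, a <= x <= b -> 0 <= df x) -> f a <= f b.
Proof.
move=> ab fdf df0; have [||c cab fE] := @MVT_segment R f df a b ab.
- by move=> x; rewrite in_itv/= => /andP[ax xb]; apply: fdf; rewrite !ltW.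
- apply/continuous_in_subspaceT => x; rewrite inE/= in_itv/= => xab.
  exact: is_derive_continuous (fdf _ xab).
- rewrite -subr_ge0 fE mulr_ge0 ?subr_ge0//; apply: df0.
  by move: cab; rewrite in_itv.
Qed.

Lemma eq_of_is_derive0 f a b : a <= b ->
  (forall x, a <= x <= b -> is_derive x 1 f 0) -> f a = f b.
Proof.
move=> ab fd0; apply/eqP; rewrite eq_le (le_of_is_derive f (fun=> 0))//=.
rewrite -lerN2; apply: (le_of_is_derive (fun y => - f y) (fun=> 0)) => //.
by move=> x xab; rewrite -oppr0; apply: is_deriveN; exact: fd0.
Qed.

Lemma lt_of_is_derive f df a b : a < b ->
  (forall x, a <= x <= b -> is_derive x 1 f (df x)) ->
  (forall x, a < x < b -> 0 < df x) -> f a < f b.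
Proof.
move=> ab fdf df0; have [||c cab fE] := @MVT R f df a b ab.
- by move=> x; rewrite in_itv/= => /andP[ax xb]; apply: fdf; rewrite !ltW.
- apply/continuous_in_subspaceT => x; rewrite inE/= in_itv/= => xab.
  exact: is_derive_continuous (fdf _ xab).
- by rewrite -subr_gt0 fE mulr_gt0 ?subr_gt0//; apply: df0.
Qed.

Lemma is_derive_fun_add f g a b x : is_derive x 1 f a -> is_derive x 1 g b ->
  is_derive x 1 (fun y => f y + g y) (a + b).
Proof. exact: is_deriveD. Qed.

Lemma is_derive_fun_sub f g a b x : is_derive x 1 f a -> is_derive x 1 g b ->
  is_derive x 1 (fun y => f y - g y) (a - b).
Proof. exact: is_deriveB. Qed.

Lemma is_derive_fun_mul f g a b x : is_derive x 1 f a -> is_derive x 1 g b ->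
  is_derive x 1 (fun y => f y * g y) (a * g x + f x * b).
Proof.
move=> fa gb; have -> : a * g x + f x * b = f x *: b + g x *: a.
  by rewrite /GRing.scale/= addrC [g x * a]mulrC.
exact: is_deriveM.
Qed.

Lemma is_derive_fun_scale f a c x : is_derive x 1 f a ->
  is_derive x 1 (fun y => c * f y) (c * a).
Proof. exact: is_deriveZ. Qed.

Lemma is_derive_fun_linear c x : is_derive x 1 (fun y => c * y) c.
Proof.
by rewrite -[X in is_derive _ _ _ X]mulr1; exact: is_derive_fun_scale.
Qed.

Lemma is_derive_fun_sqr f a x : is_derive x 1 f a ->
  is_derive x 1 (fun y => f y ^+ 2) (2 * f x * a).
Proof.
move=> fa; have -> : 2 * f x * a = a * f x + f x * a by ring.
exact: is_derive_fun_mul.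
Qed.

Lemma is_derive_fun_expR c x :
  is_derive x 1 (fun y => expR (c * y)) (c * expR (c * x)).
Proof.
rewrite mulrC; apply: (@is_derive1_comp _ expR).
exact: is_derive_fun_linear.
Qed.

Lemma is_derive_opp f a x : is_derive (- x) 1 f a ->
  is_derive x 1 (fun y => f (- y)) (- a).
Proof.
move=> fx; have -> : - a = a * (- 1) by rewrite mulrN1.
exact: (@is_derive1_comp _ f (fun y => - y)).
Qed.

Lemma is_derive_translate f a c x : is_derive (c + x) 1 f a ->
  is_derive x 1 (fun y => f (c + y)) a.
Proof.
move=> fx; have -> : a = a * (0 + 1) by rewrite add0r mulr1.
exact: (@is_derive1_comp _ f (fun y => c + y)).
Qed.

Lemma continuous_integrable_itv f a b : continuous f ->
  mu.-integrable `[a, b] (EFin \o f).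
Proof.
move=> cf; apply: continuous_compact_integrable; first exact: segment_compact.
by apply: continuous_subspaceT => x; exact: cf.
Qed.

(** On each half line [x > - r] the integral from [- r] is a primitive; these
    primitives agree where they overlap once normalized at [0], so choosing [r]
    as a function of [x] glues them into one on the whole line. *)
Lemma primitive_exists f : continuous f ->
  exists F, F 0 = 0 /\ forall x, is_derive x 1 F (f x).
Proof.
move=> cf; pose I r x := (\int[mu]_(t in `[- r, x]) f t)%R.
pose G r x := I r x - I r 0.
have dG r x : - r < x -> is_derive x 1 (G r) (f x).
  move=> rx.
  have [dI IE] := @continuous_FTC1_closed R f (- r) x (x + 1)
    (ltr_pwDr ltr01 (lexx x)) (continuous_integrable_itv f _ _ cf) rx (cf x).
  have Ix : is_derive x 1 (I r) (f x).
    by rewrite -IE derive1E; apply: derivableP.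
  rewrite -[f x]subr0.
  exact: (@is_deriveB _ _ _ (I r) (cst (I r 0))).
have GG r s x : 0 < r -> 0 < s -> - r < x -> - s < x -> G r x = G s x.
  move=> r0 s0 rx sx; apply/eqP; rewrite -subr_eq0; apply/eqP.
  pose D y := G r y - G s y.
  have D0 : D 0 = 0 by rewrite /D /G !subrr.
  have dD y : - r < y -> - s < y -> is_derive y 1 D 0.
    move=> ry sy; rewrite -(subrr (f y)).
    by apply: is_deriveB; exact: dG.
  rewrite -/(D x) -D0; case: (leP 0 x) => x0.
    apply/esym/eq_of_is_derive0 => // y /andP[y0 _].
    by apply: dD; rewrite (lt_le_trans _ y0)// oppr_lt0.
  apply: eq_of_is_derive0; first exact: ltW.
  by move=> y /andP[xy _]; apply: dD; exact: lt_le_trans xy.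
have absE x : 0 < `|x| + 1 /\ - (`|x| + 1) < x.
  split; first by rewrite ltr_wpDl.
  by rewrite ltrNl (le_lt_trans (ler_norm _))// normrN ltrDl.
exists (fun x => G (`|x| + 1) x); split; first by rewrite /G subrr.
move=> x; have [r0 rx] := absE x.
apply: near_eq_is_derive (dG _ _ rx).
near=> y; have [s0 sy] := absE y.
by apply: GG => //; near: y; exact: lt_nbhsr.
Unshelve. all: by end_near. Qed.

End Calculus.

(** * Limits of geometrically Cauchy sequences *)

Section Limits.
Context {R : realType}.
Implicit Types (c e : R).

Lemma half_pow_small c e : 0 < e -> exists k, c * 2^-1 ^+ k < e.
Proof.
move=> e0; have := archi_boundP (normr_ge0 (c / e)).
set k := Num.bound _ => ck; exists k.
have k2 : k%:R <= 2 ^+ k :> R by rewrite -natrX ler_nat ltnW// ltn_expl.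
rewrite exprVn ltr_pdivrMr ?exprn_gt0// -ltr_pdivrMl// mulrC.
exact: le_lt_trans (ler_norm _) (lt_le_trans ck k2).
Qed.

(** The limit is the supremum of the lower bounds [u k - c 2^-k], each of which
    lies below every upper bound [u j + c 2^-j]. *)
Lemma geometric_cauchy_limit (u : nat -> R) c :
  (forall k m, `|u (k + m)%N - u k| <= c * 2^-1 ^+ k) ->
  exists l, forall k, `|l - u k| <= c * 2^-1 ^+ k.
Proof.
move=> cu; pose E := range (fun k => u k - c * 2^-1 ^+ k).
have ubE j : ubound E (u j + c * 2^-1 ^+ j).
  move=> _ [k _ <-]; case: (leqP j k) => jk.
    have := cu j (k - j)%N; rewrite subnKC// ler_norml => /andP[_].
    have : 0 <= c * 2^-1 ^+ k by apply: le_trans (cu k 0%N).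
    lra.
  have := cu k (j - k)%N; rewrite (subnKC (ltnW jk)) ler_norml => /andP[+ _].
  have : 0 <= c * 2^-1 ^+ j by apply: le_trans (cu j 0%N).
  lra.
exists (sup E) => k; rewrite ler_norml; apply/andP; split.
  rewrite lerBrDl; apply: ub_le_sup; first by exists (u 0%N + c * 2^-1 ^+ 0).
  by exists k.
rewrite lerBlDl; apply: ge_sup; last exact: ubE.
by exists (u 0%N - c * 2^-1 ^+ 0); exists 0%N.
Qed.

End Limits.

(** * Existence for linear systems *)

Section LinearODE.
Context {R : realType}.
Implicit Types (F dF : R -> R) (a K M B x : R).

Lemma expR_growth_bound_half F dF a K : 0 <= a ->
  F 0 = 0 -> (forall x, is_derive x 1 F (dF x)) ->
  (forall x, 0 <= x -> dF x <= a * (K * expR (K * x))) ->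
  forall x, 0 <= x -> F x <= a * expR (K * x).
Proof.
move=> a0 F0 FdF dFle x x0; rewrite -subr_ge0.
apply: (@le_trans _ _ (a * expR (K * 0) - F 0)).
  by rewrite F0 mulr0 expR0 mulr1 subr0.
apply: (le_of_is_derive (fun y => a * expR (K * y) - F y)
                        (fun y => a * (K * expR (K * y)) - dF y)) => // y.
  move=> _; apply: is_derive_fun_sub => //.
  by apply: is_derive_fun_scale; exact: is_derive_fun_expR.
by move=> /andP[y0 _]; rewrite subr_ge0 dFle.
Qed.

(** The weight [expR (K * `|x|)] reproduces itself under integration up to the
    factor [1 / K]: this is what makes a Picard step a contraction on the whole
    line. *)
Lemma expR_growth_bound F dF a K : 0 <= a ->
  F 0 = 0 -> (forall x, is_derive x 1 F (dF x)) ->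
  (forall x, `|dF x| <= a * (K * expR (K * `|x|))) ->
  forall x, `|F x| <= a * expR (K * `|x|).
Proof.
move=> a0 F0 FdF dFle x.
have both (G dG : R -> R) : G 0 = 0 -> (forall x, is_derive x 1 G (dG x)) ->
    (forall x, 0 <= x -> `|dG x| <= a * (K * expR (K * x))) ->
    forall x, 0 <= x -> `|G x| <= a * expR (K * x).
  move=> G0 GdG dGle y y0; rewrite ler_norml lerNl; apply/andP; split.
    apply: (expR_growth_bound_half (fun y => - G y) (fun y => - dG y)) => //.
    - by rewrite G0 oppr0.
    - by move=> z z0; apply: le_trans (dGle z z0); rewrite -normrN ler_norm.
  apply: (expR_growth_bound_half G dG) => // z z0.
  by apply: le_trans (dGle z z0); rewrite ler_norm.
have [x0|x0] := leP 0 x.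
  rewrite (ger0_norm x0); apply: (both F dF) => // z z0.
  by have := dFle z; rewrite (ger0_norm z0).
have := both (fun y => F (- y)) (fun y => - dF (- y)) _ _ _ (- x).
rewrite (ltr0_norm x0) opprK; apply.
- by rewrite oppr0.
- by move=> y; exact: is_derive_opp.
- by move=> y y0; have := dFle (- y); rewrite !normrN (ger0_norm y0).
- by rewrite oppr_ge0 ltW.
Qed.

Definition lin_sol {n} (A : 'I_n -> 'I_n -> R -> R) (X : 'I_n -> R -> R) :=
  forall i x, is_derive x 1 (X i) (\sum_j A i j x * X j x).

Lemma norm_sum_mul_le n (a y : 'I_n -> R) M B : 
  (forall j, `|a j| <= M) -> (forall j, `|y j| <= B) ->
  `|\sum_j a j * y j| <= n%:R * M * B.
Proof.
move=> aM yB; apply: le_trans (ler_norm_sum _ _ _) _.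
apply: (@le_trans _ _ (\sum_(j < n) M * B)).
  by apply: ler_sum => j _; rewrite normrM ler_pM.
by rewrite sumr_const card_ord -[leLHS]mulr_natl mulrA.
Qed.

Lemma continuous_sum_mul n (a y : 'I_n -> R -> R) :
  (forall j, continuous (a j)) -> (forall j, continuous (y j)) ->
  continuous (fun x => \sum_j a j x * y j x).
Proof.
move=> ca cy x; have -> : (fun x => \sum_j a j x * y j x) = \sum_j (a j \* y j).
  by apply/funext => z; rewrite fct_sumE.
elim/big_ind : _ => [|f g cf cg|j _].
- exact: cst_continuous.
- exact: continuousD.
- by apply: continuousM; [exact: ca|exact: cy].
Qed.

(** Picard iteration.  With [K > 2 n M] one step halves every bound of the form
    [a * expR (K * `|x|)], so the iterates are geometrically Cauchy, locally
    uniformly in [x], and their limit is a fixed point of the step. *)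
Lemma lin_sol_exists n (A : 'I_n -> 'I_n -> R -> R) M (x0 : 'I_n -> R) :
  (forall i j, continuous (A i j)) -> (forall i j x, `|A i j x| <= M) ->
  exists X, lin_sol A X /\ forall i, X i 0 = x0 i.
Proof.
move=> cA AM.
have prim f : exists F, continuous f ->
    F 0 = 0 /\ forall x, is_derive x 1 F (f x).
  have [cf|ncf] := pselect (continuous f); last by exists f.
  by have [F FP] := primitive_exists f cf; exists F.
(* A primitive operator, needed as a function in order to iterate it. *)
have [P PP] := choice prim.
pose T X i x := x0 i + P (fun x => \sum_j A i j x * X j x) x.
have T0 X i : (forall j, continuous (X j)) -> T X i 0 = x0 i.
  move=> cX; rewrite /T (PP _ _).1 ?addr0//.
  exact: continuous_sum_mul.
have dT X i x : (forall j, continuous (X j)) ->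
    is_derive x 1 (T X i) (\sum_j A i j x * X j x).
  move=> cX; rewrite -[\sum_j _]add0r.
  apply: (@is_deriveD _ _ _ (cst (x0 i))).
  by apply: (PP _ _).2; exact: continuous_sum_mul.
pose S k := iter k T (fun i => cst (x0 i)).
have cS k i : continuous (S k i).
  case: k i => [|k] /= i; first exact: cst_continuous.
  elim: k i => [|k IH] i x.
    by apply: is_derive_continuous (dT _ _ _ _) => j; exact: cst_continuous.
  exact: is_derive_continuous (dT _ _ _ _).
have S0 k i : S k i 0 = x0 i.
  by case: k => [|k]//; apply: T0 => j; exact: cS.
have [n0|n0] := posnP n.
  by subst n; exists (fun i => cst 0); split=> -[].
have M0 : 0 <= M by apply: le_trans (AM (Ordinal n0) (Ordinal n0) 0).
pose K := 2 * (n%:R * M) + 1; pose C := \sum_i `|x0 i|.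
have nM0 : 0 <= n%:R * M by rewrite mulr_ge0.
have C0 : 0 <= C by exact: sumr_ge0.
have contract X Y a : 0 <= a -> (forall i, continuous (X i)) ->
    (forall i, continuous (Y i)) ->
    (forall i x, `|X i x - Y i x| <= a * expR (K * `|x|)) ->
    forall i x, `|T X i x - T Y i x| <= a * 2^-1 * expR (K * `|x|).
  move=> a0 cX cY XY i.
  apply: (expR_growth_bound _ (fun x => \sum_j A i j x * (X j x - Y j x))).
  - by rewrite mulr_ge0// invr_ge0.
  - by rewrite !T0// subrr.
  - move=> x; under eq_bigr do rewrite mulrBr.
    by rewrite sumrB; apply: is_derive_fun_sub; exact: dT.
  - move=> x.
    apply: le_trans (norm_sum_mul_le _ _ _ _ _ (AM i ^~ x) (XY ^~ x)) _.
    have e0 := expR_ge0 (K * `|x|); rewrite !mulrA ler_wpM2r//.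
    rewrite -[_ * a]mulrC -mulrA ler_wpM2l// /K; lra.
have step k i x :
    `|S k.+1 i x - S k i x| <= C * 2^-1 ^+ k * expR (K * `|x|).
  elim: k i x => [|k IH] i x.
    rewrite expr0 mulr1.
    apply: (expR_growth_bound (fun x => S 1%N i x - S 0%N i x)
                              (fun x => \sum_j A i j x * x0 j)).
    - exact: C0.
    - by rewrite !S0 subrr.
    - move=> y; rewrite -[\sum_j _]subr0; apply: is_derive_fun_sub.
      by apply: dT => j; exact: cst_continuous.
    - move=> y; have xC j : `|x0 j| <= C.
        by rewrite /C (bigD1 j)//= lerDl sumr_ge0.
      apply: le_trans (norm_sum_mul_le _ _ _ _ _ (AM i ^~ y) xC) _.
      rewrite mulrC ler_wpM2l//; apply: (@le_trans _ _ (K * 1)).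
        by rewrite /K; lra.
      rewrite ler_wpM2l//; first by rewrite /K; lra.
      by rewrite -[leLHS]expR0 ler_expR mulr_ge0// /K; lra.
  rewrite exprS mulrCA [_^-1 * _]mulrC; apply: contract => //.
    by rewrite mulr_ge0// exprn_ge0// invr_ge0.
  exact: (cS k.+1).
have [X XS] : exists X : 'I_n -> R -> R, forall i x k,
    `|X i x - S k i x| <= 2 * C * expR (K * `|x|) * 2^-1 ^+ k.
  suff H (p : 'I_n * R) : exists y, forall k,
      `|y - S k p.1 p.2| <= 2 * C * expR (K * `|p.2|) * 2^-1 ^+ k.
    have [X XP] := choice H; exists (fun i x => X (i, x)); move=> j y.
    exact: (XP (j, y)).
  apply: geometric_cauchy_limit => k m; move: p => [i x] /=.
  set E := expR _.
  have E0 : 0 <= E by exact: expR_ge0.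
  apply: (@le_trans _ _ (2 * C * E * (2^-1 ^+ k - 2^-1 ^+ (k + m)))).
    elim: m => [|m IH]; first by rewrite addn0 !subrr normr0 mulr0.
    rewrite addnS exprS.
    have := step (k + m)%N i x; rewrite -/E => st.
    apply: le_trans (ler_distD (S (k + m)%N i x) _ _) _.
    apply: le_trans (lerD st IH) _.
    by rewrite le_eqVlt; apply/orP; left; apply/eqP; field.
  by rewrite ler_wpM2l ?mulr_ge0// gerBl exprn_ge0// invr_ge0.
have cX i : continuous (X i).
  move=> x; apply/cvgrPdist_le => e e0.
  pose B := 2 * C * expR (K * (`|x| + 1)).
  have [k Bk] : exists k, B * 2^-1 ^+ k < e / 3.
    by apply: half_pow_small; rewrite divr_gt0.
  have near_bound y : `|y| <= `|x| + 1 -> `|X i y - S k i y| <= e / 3.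
    move=> yx; apply: le_trans (XS _ _ _) (le_trans _ (ltW Bk)).
    rewrite ler_wpM2r ?exprn_ge0 ?invr_ge0// ler_wpM2l ?mulr_ge0//.
    by rewrite ler_expR ler_wpM2l// /K; lra.
  have e3 : 0 < e / 3 by rewrite divr_gt0.
  have /cvgrPdist_le/(_ _ e3) := cS k i x.
  move=> Sxy.
  have nx : \forall y \near x, `|y| <= `|x| + 1.
    exists 1 => //= y xy; rewrite -lerBlDl.
    by rewrite (le_trans (lerB_dist _ _))// distrC ltW.
  near=> y.
  have xb : `|X i x - S k i x| <= e / 3 by apply: near_bound; rewrite lerDl.
  have yb : `|X i y - S k i y| <= e / 3.
    by apply: near_bound; near: y.
  have sb : `|S k i x - S k i y| <= e / 3 by near: y.
  move: xb yb sb; rewrite !ler_norml.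
  move=> /andP[? ?] /andP[? ?] /andP[? ?]; lra.
(* Both sides are within [O(2^-k)] of the iterate [S k.+1], for every [k]. *)
have XT i x : X i x = T X i x.
  apply/eqP; rewrite -subr_eq0 -normr_le0 leNgt; apply/negP => d0.
  have E0 := expR_ge0 (K * `|x|).
  have [k] := half_pow_small (4 * C * expR (K * `|x|)) _ d0.
  apply/negP; rewrite -leNgt.
  apply: le_trans (ler_distD (S k.+1 i x) _ _) _.
  have TS : `|S k.+1 i x - T X i x|
      <= 2 * C * 2^-1 ^+ k * 2^-1 * expR (K * `|x|).
    apply: contract => //; first by rewrite !mulr_ge0// exprn_ge0// invr_ge0.
    by move=> j y; rewrite distrC mulrAC; exact: XS.
  apply: le_trans (lerD (XS i x k.+1) TS) _; rewrite exprS.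
  have p0 : 0 <= 2^-1 ^+ k :> R by rewrite exprn_ge0// invr_ge0.
  have := mulr_ge0 (mulr_ge0 C0 E0) p0; lra.
exists X; split=> [i x|i]; last by rewrite XT T0.
have -> : X i = T X i by apply/funext => y; exact: XT.
exact: dT.
Unshelve. all: by end_near. Qed.

End LinearODE.

(** * Gronwall estimates for linear systems *)

Section Gronwall.
Context {R : realType}.
Implicit Types (e de : R -> R) (c d l x M eps : R).

(** The function [e x * expR (- c * x) - d * x] is nonincreasing. *)
Lemma gronwall e de c d l : 0 <= c -> 0 <= d ->
  (forall x, 0 <= x <= l -> is_derive x 1 e (de x)) ->
  (forall x, 0 <= x <= l -> de x <= c * e x + d) ->
  forall x, 0 <= x <= l -> e x <= (e 0 + d * x) * expR (c * x).
Proof.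
move=> c0 d0 ede dele x /andP[x0 xl].
pose h y := d * y - e y * expR (- c * y).
have : h 0 <= h x.
  apply: (le_of_is_derive h (fun y => d -
      (de y * expR (- c * y) + e y * (- c * expR (- c * y))))) => //.
    move=> y /andP[y0 yx]; apply: is_derive_fun_sub.
      exact: is_derive_fun_linear.
    apply: is_derive_fun_mul; last exact: is_derive_fun_expR.
    by apply: ede; rewrite y0 (le_trans yx).
  move=> y /andP[y0 yx].
  have /dele : 0 <= y <= l by rewrite y0 (le_trans yx).
  have E0 := expR_ge0 (- c * y).
  have E1 : expR (- c * y) <= 1.
    by rewrite -expR0 ler_expR mulNr oppr_le0 mulr_ge0.
  move=> dey; have := mulr_ge0 E0 (_ : 0 <= c * e y + d - de y).
  rewrite subr_ge0 => /(_ dey).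
  have : d * expR (- c * y) <= d by rewrite ler_piMr.
  lra.
rewrite /h !mulr0 expR0 mulNr expRN.
have E0 := expR_gt0 (c * x).
move=> H; have {H} : e x / expR (c * x) <= e 0 + d * x by lra.
by rewrite ler_pdivrMr.
Qed.

Lemma le_sum_nonneg n (y : 'I_n -> R) i :
  (forall j, 0 <= y j) -> y i <= \sum_j y j.
Proof. by move=> y0; rewrite (bigD1 i)//= lerDl sumr_ge0. Qed.

(** Gronwall for the energy [\sum_i Z i x ^+ 2]: by
    [2 `|a| `|b| <= a ^+ 2 + b ^+ 2] its derivative is at most
    [2 n M + 1] times itself plus [n eps ^+ 2]. *)
Lemma lin_energy n (Z H : 'I_n -> R -> R) M eps l : 0 <= M ->
  (forall i x, 0 <= x <= l -> is_derive x 1 (Z i) (H i x)) ->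
  (forall i x, 0 <= x <= l -> `|H i x| <= M * \sum_j `|Z j x| + eps) ->
  forall x, 0 <= x <= l ->
    \sum_i Z i x ^+ 2 <= (\sum_i Z i 0 ^+ 2 + n%:R * eps ^+ 2 * x)
                         * expR ((2 * n%:R * M + 1) * x).
Proof.
move=> M0 ZH HM; pose e x := \sum_i Z i x ^+ 2.
pose de x := \sum_i 2 * Z i x * H i x.
apply: (gronwall e de) => [|||x xl].
- by rewrite addr_ge0// !mulr_ge0.
- by rewrite mulr_ge0// sqr_ge0.
- move=> x xl; have -> : e = \sum_i (fun y => Z i y ^+ 2).
    by apply/funext => y; rewrite fct_sumE.
  by apply: is_derive_sum => i; apply: is_derive_fun_sqr; exact: ZH.
have n2 (a b : R) : 2 * (`|a| * `|b|) <= a ^+ 2 + b ^+ 2.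
  rewrite -(real_normK (num_real a)) -(real_normK (num_real b)).
  have := sqr_ge0 (`|a| - `|b|); lra.
apply: (@le_trans _ _
    (\sum_i (\sum_j M * (Z i x ^+ 2 + Z j x ^+ 2) + (Z i x ^+ 2 + eps ^+ 2)))).
  apply: ler_sum => i _; apply: (le_trans (ler_norm _)).
  rewrite !normrM (ger0_norm (ler0n _ 2)).
  apply: (@le_trans _ _ (2 * `|Z i x| * (M * \sum_j `|Z j x| + eps))).
    by rewrite ler_wpM2l ?mulr_ge0// HM.
  rewrite mulrDr; apply: lerD; last first.
    have := n2 (Z i x) eps; apply: le_trans.
    by rewrite mulrA ler_wpM2l ?ler_norm ?mulr_ge0.
  rewrite !mulr_sumr; apply: ler_sum => j _.
  rewrite mulrCA ler_wpM2l// -mulrA; exact: n2.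
have double : \sum_i \sum_j M * (Z i x ^+ 2 + Z j x ^+ 2) = 2 * n%:R * M * e x.
  under eq_bigr do rewrite -mulr_sumr big_split/= sumr_const card_ord -mulr_natl.
  rewrite -mulr_sumr big_split/= -mulr_sumr sumr_const card_ord -mulr_natl.
  by rewrite -/(e x); ring.
rewrite big_split/= double big_split/= sumr_const card_ord -mulr_natl -/(e x).
by rewrite le_eqVlt; apply/orP; left; apply/eqP; ring.
Qed.

Lemma norm_sum_mul_le_sum n (A : 'I_n -> 'I_n -> R -> R) (y : 'I_n -> R) M x i :
  (forall i j, `|A i j x| <= M) ->
  `|\sum_j A i j x * y j| <= M * \sum_j `|y j|.
Proof.
move=> AM; apply: le_trans (ler_norm_sum _ _ _) _; rewrite mulr_sumr.
by apply: ler_sum => j _; rewrite normrM ler_wpM2r.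
Qed.

(** The difference of the two solutions solves the system of [A] with the
    forcing [(A - B) Y], which is of order [eps] because [Y] itself is bounded
    by the energy estimate. *)
Lemma lin_sol_lipschitz n M l : 0 <= M -> 0 <= l ->
  exists C, 0 <= C /\ forall (A B : 'I_n -> 'I_n -> R -> R) X Y eps,
    0 <= eps ->
    (forall i j x, 0 <= x <= l -> [/\ `|A i j x| <= M, `|B i j x| <= M &
                                      `|A i j x - B i j x| <= eps]) ->
    lin_sol A X -> lin_sol B Y -> (forall i, X i 0 = Y i 0) ->
    (forall i, `|Y i 0| <= 1) ->
    forall i x, 0 <= x <= l -> `|X i x - Y i x| <= C * eps.
Proof.
move=> M0 l0; pose E := expR ((2 * n%:R * M + 1) * l).
have E0 : 0 <= E by exact: expR_ge0.
have Ele x : 0 <= x <= l -> expR ((2 * n%:R * M + 1) * x) <= E.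
  by move=> /andP[x0 xl]; rewrite ler_expR ler_wpM2l// addr_ge0// !mulr_ge0.
have nE0 : 0 <= n%:R * E by rewrite mulr_ge0.
pose K := n%:R * E + 1; pose D := n%:R * l * E + 1.
have nlE : 0 <= n%:R * l * E by rewrite !mulr_ge0.
have K1 : 1 <= K by rewrite lerDr.
have D1 : 1 <= D by rewrite lerDr.
have K0 := le_trans ler01 K1.
have D0 := le_trans ler01 D1.
have C0 : 0 <= n%:R * K * D by rewrite !mulr_ge0.
exists (n%:R * K * D); split=> // A B X Y eps eps0 AB AX BY XY0 Y0 i x xl.
have YK j y : 0 <= y <= l -> `|Y j y| <= K.
  move=> yl; rewrite -ler_sqr ?nnegrE//.
  rewrite real_normK ?num_real//; apply: (@le_trans _ _ (\sum_j Y j y ^+ 2)).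
    by apply: (le_sum_nonneg _ (fun j => Y j y ^+ 2)) => k; exact: sqr_ge0.
  have := lin_energy _ Y (fun i x => \sum_j B i j x * Y j x) M 0 l M0.
  move=> /(_ _ _ y yl) H; apply: (@le_trans _ _ K); last first.
    by rewrite expr2 ler_peMr.
  apply: le_trans (H _ _) _ => //.
  - move=> k z zl; rewrite addr0; apply: norm_sum_mul_le_sum => p q.
    by have [] := AB p q z zl.
  rewrite expr0n/= mulr0 mul0r addr0 /K; apply: (@le_trans _ _ (n%:R * E)).
    apply: ler_pM => //; first by apply: sumr_ge0 => k _; exact: sqr_ge0.
    + apply: (@le_trans _ _ (\sum_(k < n) 1)).
        by apply: ler_sum => k _; rewrite -real_normK ?num_real// expr_le1.
      by rewrite sumr_const card_ord.
    + by apply: Ele.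
  by rewrite lerDl.
pose Z j y := X j y - Y j y.
pose H j y := \sum_k A j k y * X k y - \sum_k B j k y * Y k y.
have ZH j y : 0 <= y <= l -> is_derive y 1 (Z j) (H j y).
  by move=> _; apply: is_derive_fun_sub; [exact: AX|exact: BY].
have HM j y : 0 <= y <= l -> `|H j y| <= M * \sum_k `|Z k y| + n%:R * eps * K.
  move=> yl; have -> : H j y = \sum_k A j k y * Z k y +
      \sum_k (A j k y - B j k y) * Y k y.
    rewrite /H -sumrB -big_split/=; apply: eq_bigr => k _; rewrite /Z; ring.
  apply: le_trans (ler_normD _ _) _; apply: lerD.
    by apply: norm_sum_mul_le_sum => p q; have [] := AB p q y yl.
  apply: (norm_sum_mul_le _ (fun k => A j k y - B j k y)) => k.
    by have [] := AB j k y yl.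
  exact: YK.
have := lin_energy _ Z H M (n%:R * eps * K) l M0 ZH HM x xl.
rewrite (_ : \sum_i Z i 0 ^+ 2 = 0); last first.
  by apply: big1 => k _; rewrite /Z XY0 subrr expr0n.
rewrite add0r => Zle; rewrite -/(Z i x) -ler_sqr ?nnegrE ?mulr_ge0//.
rewrite real_normK ?num_real//; apply: (@le_trans _ _ (\sum_j Z j x ^+ 2)).
  by apply: (le_sum_nonneg _ (fun j => Z j x ^+ 2)) => k; exact: sqr_ge0.
apply: le_trans Zle _.
have -> : (n%:R * K * D * eps) ^+ 2 = (n%:R * eps * K) ^+ 2 * D ^+ 2 by ring.
set G := expR _; have -> : n%:R * (n%:R * eps * K) ^+ 2 * x * G
  = (n%:R * eps * K) ^+ 2 * (n%:R * x * G) by ring.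
rewrite ler_wpM2l ?sqr_ge0// /G.
apply: (@le_trans _ _ D); last by rewrite expr2 ler_peMr.
rewrite /D; apply: (@le_trans _ _ (n%:R * l * E)); last by rewrite lerDl.
move: xl => /andP[x0 xl].
by rewrite ler_pM// ?mulr_ge0// ?expR_ge0 ?ler_wpM2l// Ele// x0.
Qed.

End Gronwall.

(** * Hill equations and the coupled system *)

Section Hill.
Context {R : realType}.
Implicit Types (a b q u v w : R -> R) (lam c x M : R).

(** Hill's equation [u'' = q u] as a first-order system. *)
Definition hill q u v := forall x,
  is_derive x 1 u (v x) /\ is_derive x 1 v (q x * u x).

(** The equation [S(kappa) w = lam J w] when [a = omega - q + kappa ^+ 2] and
    [b = omega - (alpha + 1) q + kappa ^+ 2]. *)
Definition coupled a b lam w1 v1 w2 v2 := forall x,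
  [/\ is_derive x 1 w1 (v1 x), is_derive x 1 v1 (a x * w1 x + lam * w2 x),
      is_derive x 1 w2 (v2 x) & is_derive x 1 v2 (b x * w2 x - lam * w1 x)].

Definition coupled_state w1 v1 w2 v2 : 'I_4 -> R -> R :=
  fun i => nth (cst 0) [:: w1; v1; w2; v2] i.

Definition coupled_matrix a b lam : 'I_4 -> 'I_4 -> R -> R := fun i j =>
  nth (cst 0) (nth [::]
    [:: [:: cst 0; cst 1; cst 0; cst 0]; [:: a; cst 0; cst lam; cst 0];
        [:: cst 0; cst 0; cst 0; cst 1]; [:: cst (- lam); cst 0; b; cst 0]] i) j.

Lemma ord4_ind (P : 'I_4 -> Prop) : P (inord 0) -> P (inord 1) ->
  P (inord 2) -> P (inord 3) -> forall i, P i.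
Proof.
move=> P0 P1 P2 P3 [[|[|[|[|//]]]] i4].
- by rewrite (_ : Ordinal i4 = inord 0)//; apply: val_inj; rewrite /= inordK.
- by rewrite (_ : Ordinal i4 = inord 1)//; apply: val_inj; rewrite /= inordK.
- by rewrite (_ : Ordinal i4 = inord 2)//; apply: val_inj; rewrite /= inordK.
- by rewrite (_ : Ordinal i4 = inord 3)//; apply: val_inj; rewrite /= inordK.
Qed.

Lemma coupled_lin_sol a b lam (X : 'I_4 -> R -> R) :
  lin_sol (coupled_matrix a b lam) X <->
  coupled a b lam (X (inord 0)) (X (inord 1)) (X (inord 2)) (X (inord 3)).
Proof.
have S i x : \sum_j coupled_matrix a b lam i j x * X j x =
    coupled_matrix a b lam i (inord 0) x * X (inord 0) x +
    coupled_matrix a b lam i (inord 1) x * X (inord 1) x +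
    coupled_matrix a b lam i (inord 2) x * X (inord 2) x +
    coupled_matrix a b lam i (inord 3) x * X (inord 3) x.
  have o0 : ord0 = inord 0 :> 'I_4 by apply: val_inj; rewrite /= inordK.
  have o1 : lift ord0 ord0 = inord 1 :> 'I_4.
    by apply: val_inj; rewrite /= inordK.
  have o2 : lift ord0 (lift ord0 ord0) = inord 2 :> 'I_4.
    by apply: val_inj; rewrite /= inordK.
  have o3 : lift ord0 (lift ord0 (lift ord0 ord0)) = inord 3 :> 'I_4.
    by apply: val_inj; rewrite /= inordK.
  by rewrite !big_ord_recl big_ord0 addr0 !addrA o3 o2 o1 o0.
have E0 x : \sum_j coupled_matrix a b lam (inord 0) j x * X j x = X (inord 1) x.
  by rewrite S /coupled_matrix !inordK//=; ring.
have E1 x : \sum_j coupled_matrix a b lam (inord 1) j x * X j x =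
    a x * X (inord 0) x + lam * X (inord 2) x.
  by rewrite S /coupled_matrix !inordK//=; ring.
have E2 x : \sum_j coupled_matrix a b lam (inord 2) j x * X j x = X (inord 3) x.
  by rewrite S /coupled_matrix !inordK//=; ring.
have E3 x : \sum_j coupled_matrix a b lam (inord 3) j x * X j x =
    b x * X (inord 2) x - lam * X (inord 0) x.
  by rewrite S /coupled_matrix !inordK//=; ring.
split=> [sX x|sX].
  by have := (sX (inord 0) x, sX (inord 1) x, sX (inord 2) x, sX (inord 3) x);
    rewrite E0 E1 E2 E3 => -[[[? ?] ?] ?].
by elim/ord4_ind => x; rewrite ?E0 ?E1 ?E2 ?E3; have [] := sX x.
Qed.

Lemma coupled_state_inord w1 v1 w2 v2 (X := coupled_state w1 v1 w2 v2) :
  [/\ X (inord 0) = w1, X (inord 1) = v1, X (inord 2) = w2 & X (inord 3) = v2].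
Proof. by rewrite /X /coupled_state !inordK. Qed.

Lemma coupled_state_sol a b lam w1 v1 w2 v2 :
  coupled a b lam w1 v1 w2 v2 ->
  lin_sol (coupled_matrix a b lam) (coupled_state w1 v1 w2 v2).
Proof.
move=> cw; apply/coupled_lin_sol.
by have [-> -> -> ->] := coupled_state_inord w1 v1 w2 v2.
Qed.

(** For checking entrywise bounds and comparisons of coefficient matrices: the
    entries other than [a], [b], [lam] and [- lam] are [0] or [1]. *)
Lemma coupled_matrix_rel (P : R -> R -> Prop) a b lam a' b' lam' x :
  P 0 0 -> P 1 1 -> P (a x) (a' x) -> P (b x) (b' x) -> P lam lam' ->
  P (- lam) (- lam') ->
  forall i j, P (coupled_matrix a b lam i j x) (coupled_matrix a' b' lam' i j x).
Proof.
move=> P0 P1 Pa Pb Pl Pn.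
by elim/ord4_ind; elim/ord4_ind; rewrite /coupled_matrix !inordK.
Qed.

Lemma coupled_exists a b lam M c1 c2 : continuous a -> continuous b ->
  (forall x, `|a x| <= M) -> (forall x, `|b x| <= M) ->
  exists w1 v1 w2 v2, [/\ coupled a b lam w1 v1 w2 v2,
    w1 0 = c1, v1 0 = 0, w2 0 = c2 & v2 0 = 0].
Proof.
move=> ca cb aM bM; pose M' := 1 + `|lam| + M.
have M0 : 0 <= M by apply: le_trans (aM 0).
have l0 := normr_ge0 lam.
have [||X [sX X0]] := @lin_sol_exists R _ (coupled_matrix a b lam) M'
    (fun i => coupled_state (cst c1) (cst 0) (cst c2) (cst 0) i 0).
- by elim/ord4_ind; elim/ord4_ind; rewrite /coupled_matrix !inordK//=;
    exact: cst_continuous.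
- move=> i j x; apply: (coupled_matrix_rel (fun y _ => `|y| <= M') a b lam a b lam).
  + by rewrite normr0 /M'; lra.
  + by rewrite normr1 /M'; lra.
  + by apply: le_trans (aM x) _; rewrite /M'; lra.
  + by apply: le_trans (bM x) _; rewrite /M'; lra.
  + by rewrite /M'; lra.
  + by rewrite normrN /M'; lra.
exists (X (inord 0)), (X (inord 1)), (X (inord 2)), (X (inord 3)).
split; first exact/coupled_lin_sol.
all: by rewrite X0 /coupled_state inordK.
Qed.

Lemma coupled_lipschitz M l : 1 <= M -> 0 <= l ->
  exists C, 0 <= C /\ forall a b lam w1 v1 w2 v2 a' b' lam' w1' v1' w2' v2' eps,
    0 <= eps ->
    (forall x, 0 <= x <= l -> [/\ `|a x| <= M, `|b x| <= M,
        `|a' x| <= M & `|b' x| <= M] /\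
        (`|a x - a' x| <= eps /\ `|b x - b' x| <= eps)) ->
    [/\ `|lam| <= M, `|lam'| <= M & `|lam - lam'| <= eps] ->
    coupled a b lam w1 v1 w2 v2 -> coupled a' b' lam' w1' v1' w2' v2' ->
    [/\ w1 0 = w1' 0, v1 0 = v1' 0, w2 0 = w2' 0 & v2 0 = v2' 0] ->
    [/\ `|w1' 0| <= 1, `|v1' 0| <= 1, `|w2' 0| <= 1 & `|v2' 0| <= 1] ->
    forall x, 0 <= x <= l -> [/\ `|w1 x - w1' x| <= C * eps,
      `|v1 x - v1' x| <= C * eps, `|w2 x - w2' x| <= C * eps &
      `|v2 x - v2' x| <= C * eps].
Proof.
move=> M1 l0; have M0 : 0 <= M by apply: le_trans M1.
have [C [C0 HC]] := lin_sol_lipschitz 4 M l M0 l0.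
exists C; split=> // a b lam w1 v1 w2 v2 a' b' lam' w1' v1' w2' v2' eps e0.
move=> ab [lM lM' le] cw cw' [e1 e2 e3 e4] [i1 i2 i3 i4] x xl.
suff H i : `|coupled_state w1 v1 w2 v2 i x - coupled_state w1' v1' w2' v2' i x|
    <= C * eps.
  have := (H (inord 0), H (inord 1), H (inord 2), H (inord 3)).
  by rewrite /coupled_state !inordK//= => -[[[? ?] ?] ?].
apply: (HC _ _ _ _ eps e0 _ (coupled_state_sol _ _ _ _ _ _ _ cw)
                            (coupled_state_sol _ _ _ _ _ _ _ cw')) => //.
- move=> {}i j y yl; have [[? ? ? ?] [? ?]] := ab y yl.
  apply: (coupled_matrix_rel (fun s t => [/\ `|s| <= M, `|t| <= M & `|s - t| <= eps])).
  + by rewrite subrr normr0.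
  + by rewrite subrr normr0 normr1.
  + by [].
  + by [].
  + by [].
  + by rewrite -opprD !normrN.
- by elim/ord4_ind; rewrite /coupled_state !inordK.
- by elim/ord4_ind; rewrite /coupled_state !inordK.
Qed.

Lemma coupled_comb a b lam w1 v1 w2 v2 w1' v1' w2' v2' c d :
  coupled a b lam w1 v1 w2 v2 -> coupled a b lam w1' v1' w2' v2' ->
  coupled a b lam (fun x => c * w1 x + d * w1' x) (fun x => c * v1 x + d * v1' x)
                  (fun x => c * w2 x + d * w2' x) (fun x => c * v2 x + d * v2' x).
Proof.
move=> cw cw' x; have [d1 d2 d3 d4] := cw x; have [d1' d2' d3' d4'] := cw' x.
have comb f g (s t : R) : is_derive x 1 f s -> is_derive x 1 g t ->
    is_derive x 1 (fun y => c * f y + d * g y) (c * s + d * t).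
  by move=> fs gt; apply: is_derive_fun_add; exact: is_derive_fun_scale.
split; [exact: comb| |exact: comb|].
- have := comb _ _ _ _ d2 d2'; congr is_derive; ring.
- have := comb _ _ _ _ d4 d4'; congr is_derive; ring.
Qed.

Lemma coupled_reflect a b lam w1 v1 w2 v2 : coupled a b lam w1 v1 w2 v2 ->
  coupled (fun x => a (- x)) (fun x => b (- x)) lam
    (fun x => w1 (- x)) (fun x => - v1 (- x))
    (fun x => w2 (- x)) (fun x => - v2 (- x)).
Proof.
move=> cw x; have [d1 d2 d3 d4] := cw (- x).
split; [exact: is_derive_opp| |exact: is_derive_opp|].
- rewrite -[X in is_derive _ _ _ X]opprK; apply: is_deriveN.
  exact: is_derive_opp.
- rewrite -[X in is_derive _ _ _ X]opprK; apply: is_deriveN.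
  exact: is_derive_opp.
Qed.

Lemma coupled_translate a b lam w1 v1 w2 v2 c : coupled a b lam w1 v1 w2 v2 ->
  coupled (fun x => a (c + x)) (fun x => b (c + x)) lam
    (fun x => w1 (c + x)) (fun x => v1 (c + x))
    (fun x => w2 (c + x)) (fun x => v2 (c + x)).
Proof.
by move=> cw x; have [d1 d2 d3 d4] := cw (c + x); split; exact: is_derive_translate.
Qed.

(** To the right of [0] this is the Lipschitz estimate between the solution and
    the zero solution of the same system, where [eps = 0]; reflection gives the
    left. *)
Lemma coupled_zero_data a b lam w1 v1 w2 v2 M :
  (forall x, `|a x| <= M) -> (forall x, `|b x| <= M) ->
  coupled a b lam w1 v1 w2 v2 ->
  [/\ w1 0 = 0, v1 0 = 0, w2 0 = 0 & v2 0 = 0] ->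
  forall x, [/\ w1 x = 0, v1 x = 0, w2 x = 0 & v2 x = 0].
Proof.
have right a' b' w1' v1' w2' v2' : (forall x, `|a' x| <= M) ->
    (forall x, `|b' x| <= M) -> coupled a' b' lam w1' v1' w2' v2' ->
    [/\ w1' 0 = 0, v1' 0 = 0, w2' 0 = 0 & v2' 0 = 0] ->
    forall x, 0 <= x -> [/\ w1' x = 0, v1' x = 0, w2' x = 0 & v2' x = 0].
  move=> aM bM cw [i1 i2 i3 i4] x x0.
  have M0 : 0 <= M by apply: le_trans (aM 0).
  have l0 := normr_ge0 lam.
  have M1 : 1 <= 1 + `|lam| + M by lra.
  have MM : M <= 1 + `|lam| + M by lra.
  have lM : `|lam| <= 1 + `|lam| + M by lra.
  have [C [C0 HC]] := coupled_lipschitz _ x M1 x0.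
  have cst0 : coupled a' b' lam (cst 0) (cst 0) (cst 0) (cst 0).
    move=> y; split; rewrite /= ?mulr0 ?addr0 ?subr0; exact: is_derive_cst.
  have := HC a' b' lam w1' v1' w2' v2' a' b' lam _ _ _ _ 0 (lexx 0) _ _ cw cst0.
  rewrite mulr0 => /(_ _ _ _ _ x) H.
  have [] := H.
  - move=> y yx; rewrite !subrr normr0; split=> //.
    by split; rewrite (le_trans _ MM).
  - by rewrite subrr normr0.
  - by split.
  - by rewrite /= normr0.
  - by rewrite x0 lexx.
  by rewrite /= !subr0 !normr_le0 => /eqP-> /eqP-> /eqP-> /eqP->.
move=> aM bM cw i0 x; have [x0|x0] := leP 0 x.
  exact: right cw i0 x x0.
have [i1 i2 i3 i4] := i0.
have := right _ _ _ _ _ _ _ _ (coupled_reflect _ _ _ _ _ _ _ cw) _ (- x).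
rewrite !opprK oppr0 i1 i2 i3 i4 !oppr0 => /(_ _ _ _ _)[] //.
  by rewrite oppr_ge0 ltW.
move=> -> /eqP; rewrite oppr_eq0 => /eqP-> -> /eqP.
by rewrite oppr_eq0 => /eqP->.
Qed.

Lemma coupled_unique a b lam w1 v1 w2 v2 w1' v1' w2' v2' M :
  (forall x, `|a x| <= M) -> (forall x, `|b x| <= M) ->
  coupled a b lam w1 v1 w2 v2 -> coupled a b lam w1' v1' w2' v2' ->
  [/\ w1 0 = w1' 0, v1 0 = v1' 0, w2 0 = w2' 0 & v2 0 = v2' 0] ->
  forall x, [/\ w1 x = w1' x, v1 x = v1' x, w2 x = w2' x & v2 x = v2' x].
Proof.
move=> aM bM cw cw' [e1 e2 e3 e4] x.
have := coupled_zero_data _ _ _ _ _ _ _ M aM bM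
  (coupled_comb _ _ _ _ _ _ _ _ _ _ _ 1 (- 1) cw cw').
have z (s t : R) : s = t -> 1 * s + -1 * t = 0 by move=> ->; ring.
rewrite !z// => /(_ _ x) []//.
by move=> ? ? ? ?; split; lra.
Qed.

Lemma hill_coupled q u v : hill q u v -> coupled q q 0 u v u v.
Proof.
by move=> h x; have [uv vq] := h x; split=> //; rewrite mul0r ?addr0 ?subr0.
Qed.

Lemma coupled_hill a b w1 v1 w2 v2 :
  coupled a b 0 w1 v1 w2 v2 -> hill a w1 v1 /\ hill b w2 v2.
Proof.
by move=> cw; split=> x; have [] := cw x; rewrite !mul0r ?addr0 ?subr0.
Qed.

Lemma hill_zero_data q u v M c : (forall x, `|q x| <= M) -> hill q u v ->
  u c = 0 -> v c = 0 -> forall x, u x = 0.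
Proof.
move=> qM h uc vc x.
have := coupled_translate _ _ _ _ _ _ _ c (hill_coupled _ _ _ h).
move/(@coupled_zero_data _ _ _ _ _ _ _ M).
by rewrite !addr0 uc vc => /(_ _ _ _ (x - c)) []//; rewrite addrC subrK.
Qed.

Lemma hill_unique q u v u' v' M : (forall x, `|q x| <= M) ->
  hill q u v -> hill q u' v' -> u 0 = u' 0 -> v 0 = v' 0 ->
  forall x, u x = u' x /\ v x = v' x.
Proof.
move=> qM /hill_coupled h /hill_coupled h' uu vv x.
by have [] := coupled_unique _ _ _ _ _ _ _ _ _ _ _ M qM qM h h' _ x.
Qed.

Lemma hill_exists q M : continuous q -> (forall x, `|q x| <= M) ->
  exists u v, [/\ hill q u v, u 0 = 1 & v 0 = 0].
Proof.
move=> cq qM.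
have [w1 [v1 [w2 [v2 [/coupled_hill[h _] i1 i2 _ _]]]]] :=
  coupled_exists q q 0 M 1 1 cq cq qM qM.
by exists w1, v1.
Qed.

End Hill.

(** * Comparison with a positive solution *)

Section Comparison.
Context {R : realType}.
Implicit Types (f df p dp q r s c u v : R -> R) (l x M : R) (U V : R -> R -> R).

Lemma hill_continuous q u v : hill q u v -> continuous u /\ continuous v.
Proof.
by move=> h; split=> x; have [uv vq] := h x; exact: is_derive_continuous.
Qed.

Lemma pos_of_nonvanishing f l : 0 <= l -> continuous f ->
  (forall x, 0 <= x <= l -> f x != 0) -> 0 < f 0 ->
  forall x, 0 <= x <= l -> 0 < f x.
Proof.
move=> l0 cf fn0 f0 x /andP[x0 xl]; rewrite ltNge; apply/negP => fx.
have [||c cx fc] := @IVT R f 0 x 0 x0.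
- by apply: continuous_subspaceT => y; exact: cf.
- by rewrite ge_min fx orbT/= le_max (ltW f0).
- move: cx; rewrite in_itv/= => /andP[c0 cx].
  by have := fn0 c; rewrite c0 (le_trans cx)//= fc eqxx => /(_ isT).
Qed.

Lemma wronskian_derive q r u v p dp x : hill q u v -> hill r p dp ->
  is_derive x 1 (fun y => v y * p y - u y * dp y) ((q x - r x) * (u x * p x)).
Proof.
move=> huv hp; have [uv vq] := huv x; have [pd dpr] := hp x.
have := is_derive_fun_sub _ _ _ _ _ (is_derive_fun_mul _ _ _ _ _ vq pd)
  (is_derive_fun_mul _ _ _ _ _ uv dpr).
by congr is_derive; ring.
Qed.

Lemma quotient_derive u v p dp x : p x != 0 ->
  is_derive x 1 u (v x) -> is_derive x 1 p (dp x) ->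
  is_derive x 1 (fun y => u y / p y) ((v x * p x - u x * dp x) / p x ^+ 2).
Proof.
move=> px0 uv pd; have := is_derive_fun_mul _ _ _ _ _ uv (is_deriveV px0 pd).
by congr is_derive; rewrite /GRing.scale/=; field.
Qed.

(** With [W = v p - u p'] and [z = u / p] one has [W' = c u p] and
    [z' = W / p ^+ 2], so [(W z)' = c u ^+ 2 + (W / p) ^+ 2 >= 0].  Hence
    [W z >= 0], which makes [z ^+ 2] nondecreasing: [z] cannot vanish, and
    [W z > 0] at [l], where [W = v p]. *)
Lemma hill_growth r c p dp u v l : 0 < l -> (forall x, 0 < p x) ->
  (forall x, 0 <= x <= l -> 0 < c x) -> hill r p dp -> dp 0 = 0 -> dp l = 0 ->
  hill (fun x => r x + c x) u v -> u 0 = 1 -> v 0 = 0 ->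
  (forall x, 0 <= x <= l -> 0 < u x) /\ 0 < v l.
Proof.
move=> l0 p0 c0 hp dp0 dpl hu u0 v0.
have [cp _] := hill_continuous _ _ _ hp.
have [cu _] := hill_continuous _ _ _ hu.
pose W x := v x * p x - u x * dp x; pose z x := u x / p x.
have pn0 x : p x != 0 by rewrite gt_eqF.
have dW x : is_derive x 1 W (c x * (u x * p x)).
  by have := wronskian_derive _ _ _ _ _ _ x hu hp; congr is_derive; ring.
have dz x : is_derive x 1 z (W x / p x ^+ 2).
  by apply: quotient_derive => //; [case: (hu x)|case: (hp x)].
have dWz x : is_derive x 1 (fun y => W y * z y)
    (c x * u x ^+ 2 + W x ^+ 2 / p x ^+ 2).
  have := is_derive_fun_mul _ _ _ _ _ (dW x) (dz x).
  by congr is_derive; rewrite /z; field.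
have W0 : W 0 * z 0 = 0 by rewrite /W v0 dp0 !(mul0r, mulr0) subrr mul0r.
have sq0 x : 0 <= W x ^+ 2 / p x ^+ 2 by rewrite divr_ge0// sqr_ge0.
have Wz x : 0 <= x <= l -> 0 <= W x * z x.
  move=> /andP[x0 xl]; rewrite -W0.
  apply: (le_of_is_derive (fun y => W y * z y)
    (fun y => c y * u y ^+ 2 + W y ^+ 2 / p y ^+ 2)) => // y /andP[y0 yx].
  rewrite addr_ge0// mulr_ge0 ?sqr_ge0// ltW// c0//.
  by rewrite y0 (le_trans yx).
have z0 : 0 < z 0 by rewrite /z u0 divr_gt0.
have zz x : 0 <= x <= l -> z 0 ^+ 2 <= z x ^+ 2.
  move=> /andP[x0 xl].
  apply: (le_of_is_derive (fun y => z y ^+ 2)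
    (fun y => 2 * z y * (W y / p y ^+ 2))) => // y.
    by move=> _; exact: is_derive_fun_sqr.
  move=> /andP[y0 yx]; have yl : 0 <= y <= l by rewrite y0 (le_trans yx).
  have -> : 2 * z y * (W y / p y ^+ 2) = 2 * (W y * z y) / p y ^+ 2 by ring.
  by rewrite divr_ge0 ?sqr_ge0// mulr_ge0// Wz.
have zn0 x : 0 <= x <= l -> z x != 0.
  move=> xl; apply/eqP => zx; have := zz x xl.
  by rewrite zx expr0n/= leNgt exprn_gt0.
have cz : continuous z by move=> x; exact: is_derive_continuous (dz x).
have zp := pos_of_nonvanishing z l (ltW l0) cz zn0 z0.
have up x : 0 <= x <= l -> 0 < u x.
  move=> xl; have := mulr_gt0 (zp x xl) (p0 x).
  by rewrite /z divfK.
split=> //.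
have : W 0 * z 0 < W l * z l.
  apply: (lt_of_is_derive (fun y => W y * z y)
    (fun y => c y * u y ^+ 2 + W y ^+ 2 / p y ^+ 2)) => // y /andP[y0 yl].
  have yl' : 0 <= y <= l by rewrite !ltW.
  by rewrite ltr_pwDl// mulr_gt0 ?c0// exprn_gt0// up.
have ll : 0 <= l <= l by rewrite ltW/=.
rewrite W0 pmulr_lgt0 ?zp// /W dpl mulr0 subr0 pmulr_lgt0//.
Qed.

(** The Wronskian [v p - u p'] vanishes at [0] and has derivative
    [- s u p < 0]; at [l] it is [v p]. *)
Lemma hill_decay r s p dp u v l : 0 < l -> (forall x, 0 < p x) ->
  (forall x, 0 <= x <= l -> 0 < s x) -> hill r p dp -> dp 0 = 0 -> dp l = 0 ->
  hill (fun x => r x - s x) u v -> v 0 = 0 ->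
  (forall x, 0 <= x <= l -> 0 < u x) -> v l < 0.
Proof.
move=> l0 p0 s0 hp dp0 dpl hu v0 up.
pose W x := v x * p x - u x * dp x.
have : - W 0 < - W l.
  apply: (lt_of_is_derive (fun y => - W y) (fun y => s y * (u y * p y))) => // y.
    move=> _; have := wronskian_derive _ _ _ _ _ _ y hu hp.
    move=> /(@is_deriveN _ _ _ _ _ _ _); congr is_derive; ring.
  move=> /andP[y0 yl]; have yl' : 0 <= y <= l by rewrite !ltW.
  by rewrite mulr_gt0 ?s0// mulr_gt0 ?up.
rewrite /W v0 dp0 dpl !mulr0 mul0r !subr0 oppr0 oppr_gt0.
by rewrite pmulr_llt0.
Qed.

Lemma lt_left_of_pos_slope q u v x e : hill q u v -> 0 < v x -> 0 < e ->
  exists2 d, 0 < d <= e & u (x - d) < u x.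
Proof.
move=> h vx e0; have [_ cv] := hill_continuous _ _ _ h.
have /cvgrPdist_lt/(_ _ vx)[d/= d0 vd] := cv x.
have m0 : 0 < Num.min (d / 2) e by rewrite lt_min e0 divr_gt0.
exists (Num.min (d / 2) e); first by rewrite m0 ge_min lexx orbT.
apply: (lt_of_is_derive u v); first by rewrite gtrBl.
  by move=> y _; case: (h y).
move=> y /andP[xy yx]; have := vd y; rewrite /ball_/= => H.
have : `|x - y| < d.
  rewrite ger0_norm ?subr_ge0 ?ltW//.
  have : Num.min (d / 2) e <= d / 2 by rewrite ge_min lexx.
  lra.
move=> /H; rewrite ltr_norml => /andP[_]; lra.
Qed.

(** A zero of a nonnegative nonzero solution has nonzero slope, since otherwise
    the Cauchy data vanish there.  A nonzero slope makes [u] negative on one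
    side, so the zero is the right end point. *)
Lemma hill_nonneg_zero q u v M l x : (forall y, `|q y| <= M) -> hill q u v ->
  u 0 = 1 -> (forall y, 0 <= y <= l -> 0 <= u y) -> 0 <= x <= l -> u x = 0 ->
  x = l /\ v l < 0.
Proof.
move=> qM h u0 unn /andP[x0 xl] ux.
have xpos : 0 < x.
  rewrite lt_neqAle x0 andbT; apply/eqP => x00.
  by move: ux; rewrite -x00 u0 => /eqP; rewrite oner_eq0.
have vx0 : v x != 0.
  apply/eqP => vx; have := hill_zero_data _ _ _ M x qM h ux vx 0.
  by rewrite u0 => /eqP; rewrite oner_eq0.
have vle : v x <= 0.
  rewrite leNgt; apply/negP => vx.
  have [d /andP[d0 dx]] := lt_left_of_pos_slope _ _ _ _ _ h vx xpos.
  rewrite ux ltNge unn//; apply/andP; split; lra.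
have vlt : v x < 0 by rewrite lt_neqAle vx0.
suff xE : x = l by rewrite -xE.
apply/eqP; rewrite eq_le xl/= leNgt; apply/negP => xltl.
have h' : hill (fun y => q (- y)) (fun y => u (- y)) (fun y => - v (- y)).
  move=> y; have [uv vq] := h (- y); split; first exact: is_derive_opp.
  rewrite -[X in is_derive _ _ _ X]opprK; apply: is_deriveN; exact: is_derive_opp.
have [||d /andP[d0 dl]] := lt_left_of_pos_slope _ _ _ (- x) (l - x) h'.
- by rewrite opprK oppr_gt0.
- by rewrite subr_gt0.
- rewrite opprK ux ltNge unn//; apply/andP; split; lra.
Qed.

End Comparison.

(** * A negative Neumann datum *)

Section Crossing.
Context {R : realType}.
Implicit Types (p dp q r s u v : R -> R) (l x m M C : R) (U V : R -> R -> R).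

Lemma hill_lipschitz q U V l M B : 0 <= l -> 0 <= B -> (forall x, `|q x| <= M) ->
  (forall m, 0 <= m -> [/\ hill (fun x => q x + m) (U m) (V m), U m 0 = 1 &
                           V m 0 = 0]) ->
  exists2 C, 0 < C & forall m m' x, 0 <= m <= B -> 0 <= m' <= B -> 0 <= x <= l ->
    `|U m x - U m' x| <= C * `|m - m'| /\ `|V m x - V m' x| <= C * `|m - m'|.
Proof.
move=> l0 B0 qM UV; have M0 : 0 <= M by apply: le_trans (qM 0).
have M1 : 1 <= 1 + M + B by lra.
have [C [C0 HC]] := coupled_lipschitz _ l M1 l0.
exists (C + 1); first by rewrite ltr_wpDl.
move=> m m' x /andP[m0 mB] /andP[m0' mB'] xl.
have [hm U0 V0] := UV m m0; have [hm' U0' V0'] := UV m' m0'.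
have qm k y : 0 <= k -> k <= B -> `|q y + k| <= 1 + M + B.
  move=> k0 kB; rewrite (le_trans (ler_normD _ _))// (ger0_norm k0).
  by have := qM y; lra.
have [|||||H1 H2 _ _] := HC _ _ _ _ _ _ _ _ _ _ _ _ _ _ `|m - m'| _ _ _
  (hill_coupled _ _ _ hm) (hill_coupled _ _ _ hm') _ _ x xl.
- exact: normr_ge0.
- move=> y _; split; first by split; exact: qm.
  by rewrite (_ : q y + m - (q y + m') = m - m')//; ring.
- by rewrite subrr normr0; split=> //; lra.
- by rewrite U0 U0' V0 V0'.
- by rewrite U0' V0' normr0 normr1.
have := normr_ge0 (m - m'); split; lra.
Qed.

(** Let [m] be the infimum of the parameters for which the solution is positive
    on [0, l].  If the limiting solution is still positive, positivity is stable
    under small changes of the parameter, so [m = 0] and [hill_decay] applies;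
    otherwise [hill_nonneg_zero] does.  In both cases the slope at [l] is
    negative at [m >= 0], hence also slightly above [m]. *)
Lemma hill_neumann_negative r s p dp U V l M : 0 < l ->
  (forall x, `|r x| <= M) -> (forall x, `|s x| <= M) -> (forall x, 0 < s x) ->
  (forall x, 0 < p x) -> hill r p dp -> dp 0 = 0 -> dp l = 0 ->
  (forall m, 0 <= m -> [/\ hill (fun x => r x - s x + m) (U m) (V m), U m 0 = 1 &
                           V m 0 = 0]) ->
  exists2 m, 0 < m & V m l < 0.
Proof.
move=> l0 rM sM s0 p0 hp dp0 dpl UV.
have M0 : 0 <= M by apply: le_trans (rM 0).
have B0 : 0 <= M + 2 by lra.
have rsM x : `|r x - s x| <= M + M.
  by rewrite (le_trans (ler_normB _ _))// lerD.
have [C C0 UVC] := hill_lipschitz _ U V l _ _ (ltW l0) B0 rsM UV.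
pose P := [set m | 0 <= m /\ forall x, 0 <= x <= l -> 0 < U m x].
(* Beyond the maximum of [s] the solution grows relative to [p]. *)
have PM : P (M + 1).
  have M1 : 0 <= M + 1 by lra.
  have [hM U0 V0] := UV _ M1; split=> //.
  have [||//] := hill_growth r (fun x => - s x + (M + 1)) p dp (U (M + 1))
    (V (M + 1)) l l0 p0 _ hp dp0 dpl _ U0 V0.
  - by move=> x _; have := sM x; rewrite ler_norml => /andP[_]; lra.
  - by move=> x; have [? ?] := hM x; split=> //; rewrite addrA.
have lbP : lbound P 0 by move=> m [].
have hiP : has_inf P by split; [exists (M + 1)|exists 0].
pose m := inf P.
have m0 : 0 <= m by apply: lb_le_inf => //; exists (M + 1).
have mM : m <= M + 1 by apply: ge_inf => //; exists 0.
have mB : 0 <= m <= M + 2 by rewrite m0; lra.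
have [hm U0 V0] := UV m m0.
have unn x : 0 <= x <= l -> 0 <= U m x.
  move=> xl; rewrite leNgt; apply/negP => ux.
  have e0 : 0 < Num.min 1 (- U m x / C).
    by rewrite lt_min ltr01 divr_gt0// oppr_gt0.
  have [m' [m0' Um'] mm'] := inf_adherent e0 hiP.
  have m'm : m <= m' by apply: ge_inf => //; exists 0.
  have : m' - m < 1 /\ m' - m < - U m x / C.
    split; apply: lt_le_trans (_ : Num.min 1 (- U m x / C) <= _);
      rewrite ?ltrBlDl// ge_min lexx ?orbT//.
  move=> [m1]; rewrite ltr_pdivlMr// => m2.
  have mB' : 0 <= m' <= M + 2 by rewrite m0'; lra.
  have [+ _] := UVC m' m x mB' mB xl.
  have mm0 : 0 <= m' - m by rewrite subr_ge0.
  by rewrite (ger0_norm mm0) ler_norml => /andP[_]; have := Um' x xl; lra.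
have Vm : V m l < 0.
  have [[x [xl ux]]|npos] := pselect (exists x, 0 <= x <= l /\ U m x <= 0).
    have ux0 : U m x = 0 by apply/eqP; rewrite eq_le ux unn.
    have qM y : `|r y - s y + m| <= M + M + m.
      by rewrite (le_trans (ler_normD _ _))// (ger0_norm m0) lerD2r.
    by have [] := hill_nonneg_zero _ _ _ _ l x qM hm U0 unn xl ux0.
  have up x : 0 <= x <= l -> 0 < U m x.
    by move=> xl; rewrite ltNge; apply/negP => ux; apply: npos; exists x.
  have mE : m = 0.
    apply/eqP; rewrite eq_le m0 andbT leNgt; apply/negP => mp.
    have [|x xl xmin] := @EVT_min R (U m) 0 l (ltW l0).
      apply: continuous_subspaceT => y.
      by have [cu _] := hill_continuous _ _ _ hm; exact: cu.
    have ux : 0 < U m x by apply: up; move: xl; rewrite in_itv.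
    (* Lowering [m] by [d] moves the solution by at most half its minimum, so it
       stays positive, against the choice of [m]. *)
    pose d := Num.min m (U m x / (2 * C)).
    have d0 : 0 < d by rewrite lt_min mp divr_gt0// mulr_gt0.
    have dm : d <= m by rewrite ge_min lexx.
    have : d <= U m x / (2 * C) by rewrite ge_min lexx orbT.
    rewrite ler_pdivlMr ?mulr_gt0// => dC.
    have : P (m - d).
      split; first by rewrite subr_ge0.
      move=> y yl; have mdB : 0 <= m - d <= M + 2 by apply/andP; split; lra.
      have [+ _] := UVC (m - d) m y mdB mB yl.
      have -> : `|m - d - m| = d by rewrite addrAC subrr add0r normrN gtr0_norm.
      rewrite ler_norml => /andP[+ _].
      have : U m x <= U m y by apply: xmin; rewrite in_itv.
      by lra.
    move=> /(ge_inf (ex_intro _ 0 lbP)); rewrite -/m; lra.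
  apply: (hill_decay r s p dp (U m) (V m)) => //.
  by move=> x; have := hm x; rewrite mE addr0.
pose d := Num.min 1 (- V m l / (2 * C)).
have d0 : 0 < d by rewrite lt_min ltr01 divr_gt0 ?oppr_gt0// mulr_gt0.
have d1 : d <= 1 by rewrite ge_min lexx.
have : d <= - V m l / (2 * C) by rewrite ge_min lexx orbT.
rewrite ler_pdivlMr ?mulr_gt0// => dC.
exists (m + d); first by rewrite ltr_wpDl.
have mdB : 0 <= m + d <= M + 2 by apply/andP; split; lra.
have ll : 0 <= l <= l by rewrite ltW/=.
have [_] := UVC (m + d) m l mdB mB ll.
have -> : `|m + d - m| = d by rewrite addrAC subrr add0r gtr0_norm.
by rewrite ler_norml => /andP[_]; lra.
Qed.

End Crossing.

(** * Shooting on the half period *)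

Section NeumannMode.
Context {R : realType}.
Implicit Types (f p dp q r s u v w : R -> R) (l x t m M C lam : R).

Lemma lipschitz_within_continuous f C :
  (forall t t', 0 <= t <= 1 -> 0 <= t' <= 1 -> `|f t - f t'| <= C * `|t - t'|) ->
  {within `[0, 1], continuous f}.
Proof.
move=> fC; have C0 : 0 <= C.
  have := fC 0 1; rewrite !lexx ler01 sub0r normrN normr1 mulr1 => /(_ isT isT).
  exact: le_trans.
apply/subspace_continuousP => t; rewrite /= in_itv/= => t01.
apply/cvgrPdist_le => e e0; near=> t'.
have t01' : 0 <= t' <= 1.
  suff : t' \in `[0, 1] by rewrite in_itv.
  by near: t'; exact: withinT.
apply: le_trans (fC t t' t01 t01') _.
have : `|t - t'| <= e / (C + 1).
  near: t'; apply: cvg_within; rewrite /=.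
  have eC : 0 < e / (C + 1) by rewrite divr_gt0// ltr_wpDl.
  exact: (@cvgr_dist_le _ _ _ _ _ id t cvg_id _ eC).
rewrite ler_pdivlMr ?ltr_wpDl//; have := normr_ge0 (t - t'); lra.
Unshelve. all: by end_near. Qed.

Lemma within_continuous_det (a b c d : R -> R) (E : set R) :
  {within E, continuous a} -> {within E, continuous b} ->
  {within E, continuous c} -> {within E, continuous d} ->
  {within E, continuous (fun t => a t * d t - c t * b t)}.
Proof.
move=> /subspace_continuousP ca /subspace_continuousP cb /subspace_continuousP cc.
move=> /subspace_continuousP cd; apply/subspace_continuousP => t Et.
by apply: cvgB; apply: cvgM; [exact: ca|exact: cd|exact: cc|exact: cb].
Qed.

Lemma singular_2x2 (a b c d : R) : a * d - c * b = 0 ->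
  exists y z, [/\ y * a + z * b = 0, y * c + z * d = 0 & (y != 0) || (z != 0)].
Proof.
move=> D0; have [/andP[/eqP a0 /eqP b0]|ab] := boolP ((a == 0) && (b == 0)).
  have [/andP[/eqP c0 /eqP d0]|cd] := boolP ((c == 0) && (d == 0)).
    by exists 1, 0; rewrite a0 b0 c0 d0 !mulr0 addr0 oner_eq0.
  exists d, (- c); split; first by rewrite a0 b0 !mulr0 addr0.
    by rewrite mulNr mulrC subrr.
  by move: cd; rewrite negb_and oppr_eq0 orbC.
exists b, (- a); split; first by rewrite mulNr mulrC subrr.
  have -> : b * c + - a * d = - (a * d - c * b) by ring.
  by rewrite D0 oppr0.
by move: ab; rewrite negb_and oppr_eq0 orbC.
Qed.

Lemma coupled_path_lipschitz r s (lam mu : R -> R) l M K c1 c2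
    (X : R -> (R -> R) * (R -> R) * (R -> R) * (R -> R)) : 0 <= l ->
  (forall x, `|r x| <= M) -> (forall x, `|s x| <= M) -> 0 <= K ->
  (forall t, 0 <= t <= 1 -> `|lam t| <= K /\ `|mu t| <= K) ->
  (forall t t', 0 <= t <= 1 -> 0 <= t' <= 1 ->
    `|lam t - lam t'| <= K * `|t - t'| /\ `|mu t - mu t'| <= K * `|t - t'|) ->
  `|c1| <= 1 -> `|c2| <= 1 ->
  (forall t, coupled (fun x => r x + mu t) (fun x => s x + mu t) (lam t)
      (X t).1.1.1 (X t).1.1.2 (X t).1.2 (X t).2 /\
    [/\ (X t).1.1.1 0 = c1, (X t).1.1.2 0 = 0, (X t).1.2 0 = c2 &
        (X t).2 0 = 0]) ->
  {within `[0, 1], continuous (fun t => (X t).1.1.2 l)} /\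
  {within `[0, 1], continuous (fun t => (X t).2 l)}.
Proof.
move=> l0 rM sM K0 bound lip c11 c21 XP; have M0 := le_trans (normr_ge0 _) (rM 0).
have ll : 0 <= l <= l by rewrite l0/=.
have N1 : 1 <= 1 + M + K by lra.
have KN : K <= 1 + M + K by lra.
have MN k : k <= K -> M + k <= 1 + M + K by lra.
have [C [C0 HC]] := coupled_lipschitz _ l N1 l0.
have fM (f : R -> R) t x : (forall x, `|f x| <= M) -> 0 <= t <= 1 ->
    `|f x + mu t| <= 1 + M + K.
  move=> fM /bound[_ mK]; apply: le_trans (MN _ mK).
  by rewrite (le_trans (ler_normD _ _))// lerD2r.
have fD (f : R -> R) t t' x : f x + mu t - (f x + mu t') = mu t - mu t' by ring.
suff H t t' : 0 <= t <= 1 -> 0 <= t' <= 1 ->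
      `|(X t).1.1.2 l - (X t').1.1.2 l| <= C * K * `|t - t'| /\
      `|(X t).2 l - (X t').2 l| <= C * K * `|t - t'|.
  by split; apply: (lipschitz_within_continuous _ (C * K)) => t t' t1 t2;
    have [] := H t t' t1 t2.
move=> t01 t01'; have [cX [i1 i2 i3 i4]] := XP t.
have [cX' [i1' i2' i3' i4']] := XP t'; have [dl dm] := lip t t' t01 t01'.
have [lK _] := bound t t01; have [lK' _] := bound t' t01'.
have [|||||_ H1 _ H2] := HC _ _ _ _ _ _ _ _ _ _ _ _ _ _ (K * `|t - t'|)
  _ _ _ cX cX' _ _ l ll.
- by rewrite mulr_ge0.
- by move=> x _; rewrite !fD; split=> //; split; exact: fM.
- by split=> //; apply: le_trans KN.
- by rewrite i1 i2 i3 i4 i1' i2' i3' i4'.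
- by rewrite i1' i2' i3' i4' normr0 ler01.
by rewrite -!mulrA.
Qed.

Lemma parabola_lipschitz K t t' : 3 <= K -> 0 <= t <= 1 -> 0 <= t' <= 1 ->
  `|t * (1 - t)| <= K /\
  `|t * (1 - t) - t' * (1 - t')| <= K * `|t - t'|.
Proof.
move=> K3 /andP[t0 t1] /andP[t0' t1']; split.
  by rewrite ger0_norm ?mulr_ge0 ?subr_ge0//; nra.
have -> : t * (1 - t) - t' * (1 - t') = (1 - t - t') * (t - t') by ring.
by rewrite normrM ler_wpM2r// ler_norml; apply/andP; split; lra.
Qed.

Lemma segment_lipschitz m n K t t' : 0 < m -> 0 < n -> m + n <= K ->
  0 <= t <= 1 -> `|(1 - t) * m + t * n| <= K /\
  `|(1 - t) * m + t * n - ((1 - t') * m + t' * n)| <= K * `|t - t'|.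
Proof.
move=> m0 n0 mnK /andP[t0 t1]; split.
  rewrite ger0_norm ?addr_ge0 ?mulr_ge0 ?subr_ge0 ?(ltW m0) ?(ltW n0)//.
  have t1' : 0 <= 1 - t by rewrite subr_ge0.
  have := mulr_ge0 t0 (ltW m0); have := mulr_ge0 t1' (ltW n0); lra.
have -> : (1 - t) * m + t * n - ((1 - t') * m + t' * n) = (n - m) * (t - t').
  by ring.
by rewrite normrM ler_wpM2r// ler_norml; apply/andP; split; lra.
Qed.

(** The determinant [D] of the Neumann data is negative at [t = 0] and positive
    at [t = 1], where [lam] vanishes and it is a product; the factor [t (1 - t)]
    makes [lam] positive at any zero in between. *)
Lemma coupled_neumann_exists r s p dp l M : 0 < l ->
  continuous r -> continuous s ->
  (forall x, `|r x| <= M) -> (forall x, `|s x| <= M) -> (forall x, 0 < s x) ->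
  (forall x, 0 < p x) -> hill r p dp -> dp 0 = 0 -> dp l = 0 ->
  exists lam m w1 v1 w2 v2, [/\ 0 < lam, 0 < m,
    coupled (fun x => r x + m) (fun x => r x - s x + m) lam w1 v1 w2 v2,
    [/\ v1 0 = 0, v2 0 = 0, v1 l = 0 & v2 l = 0] & (w1 0 != 0) || (w2 0 != 0)].
Proof.
move=> l0 cr cs rM sM s0 p0 hp dp0 dpl.
have M0 : 0 <= M by apply: le_trans (rM 0).
have rsM x : `|r x - s x| <= M + M.
  by rewrite (le_trans (ler_normB _ _))// lerD.
have rmM m x : `|r x + m| <= M + M + `|m|.
  rewrite (le_trans (ler_normD _ _))// lerD2r (le_trans (rM x))//; lra.
have rsmM m x : `|r x - s x + m| <= M + M + `|m|.
  by rewrite (le_trans (ler_normD _ _))// lerD2r.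
have crm m : continuous (fun x => r x + m).
  by move=> x; apply: cvgD; [exact: cr|exact: cvg_cst].
have crsm m : continuous (fun x => r x - s x + m).
  move=> x; apply: cvgD; [|exact: cvg_cst].
  by apply: cvgB; [exact: cr|exact: cs].
have [m1 m10 crossing] : exists2 m, 0 < m & forall u v,
    hill (fun x => r x - s x + m) u v -> u 0 = 1 -> v 0 = 0 -> v l < 0.
  have sol m : exists uv : (R -> R) * (R -> R),
      [/\ hill (fun x => r x - s x + m) uv.1 uv.2, uv.1 0 = 1 & uv.2 0 = 0].
    have [u [v uvP]] := hill_exists _ _ (crsm m) (rsmM m).
    by exists (u, v).
  have [UV UVP] := choice sol.
  have [m m0 Vm] := hill_neumann_negative r s p dp (fun m => (UV m).1)
    (fun m => (UV m).2) l M l0 rM sM s0 p0 hp dp0 dpl (fun m _ => UVP m).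
  exists m => // u v h u0 v0; have [hm U0 V0] := UVP m.
  have [||_ ->] // := hill_unique _ _ _ _ _ _ (rsmM m) h hm _ _ l.
  - by rewrite u0 U0.
  - by rewrite v0 V0.
(* For [m2 > sup s] both scalar factors of [D] are positive. *)
pose m2 := M + 1; have m20 : 0 < m2 by rewrite ltr_wpDl.
pose lam t := t * (1 - t); pose mu t := (1 - t) * m1 + t * m2.
have sol c1 c2 t : exists w : (R -> R) * (R -> R) * (R -> R) * (R -> R),
    coupled (fun x => r x + mu t) (fun x => r x - s x + mu t) (lam t)
      w.1.1.1 w.1.1.2 w.1.2 w.2 /\
    [/\ w.1.1.1 0 = c1, w.1.1.2 0 = 0, w.1.2 0 = c2 & w.2 0 = 0].
  have [w1 [v1 [w2 [v2 [cw i1 i2 i3 i4]]]]] := coupled_exists _ _ (lam t) _ c1 c2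
    (crm (mu t)) (crsm (mu t)) (rmM (mu t)) (rsmM (mu t)).
  by exists (w1, v1, w2, v2).
have [A AP] := choice (sol 1 0); have [B BP] := choice (sol 0 1).
pose K := m1 + m2 + 3.
have K3 : 3 <= K by rewrite lerDr addr_ge0 ?ltW.
have K0 : 0 <= K by apply: le_trans K3.
have mK : m1 + m2 <= K by rewrite lerDl.
have n0 : `|0 : R| <= 1 by rewrite normr0.
have n1 : `|1 : R| <= 1 by rewrite normr1.
have bound t : 0 <= t <= 1 -> `|lam t| <= K /\ `|mu t| <= K.
  move=> t01; have [? _] := parabola_lipschitz K t t K3 t01 t01.
  by have [? _] := segment_lipschitz m1 m2 K t t m10 m20 mK t01.
have lip t t' : 0 <= t <= 1 -> 0 <= t' <= 1 ->
    `|lam t - lam t'| <= K * `|t - t'| /\ `|mu t - mu t'| <= K * `|t - t'|.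
  move=> t01 t01'; have [_ ?] := parabola_lipschitz K t t' K3 t01 t01'.
  by have [_ ?] := segment_lipschitz m1 m2 K t t' m10 m20 mK t01.
have rM2 x : `|r x| <= M + M by rewrite (le_trans (rM x))// lerDl.
have [cA1 cA2] := coupled_path_lipschitz r (fun x => r x - s x) lam mu l _ K
  1 0 A (ltW l0) rM2 rsM K0 bound lip n1 n0 AP.
have [cB1 cB2] := coupled_path_lipschitz r (fun x => r x - s x) lam mu l _ K
  0 1 B (ltW l0) rM2 rsM K0 bound lip n0 n1 BP.
pose D t := (A t).1.1.2 l * (B t).2 l - (A t).2 l * (B t).1.1.2 l.
have cD : {within `[0, 1], continuous D} by exact: within_continuous_det.
(* Where [lam] vanishes the system decouples and [D] is a product. *)
have decoupled t : lam t = 0 -> 0 < mu t -> exists2 e, 0 < e & exists u v,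
    [/\ hill (fun x => r x - s x + mu t) u v, u 0 = 1, v 0 = 0 & D t = e * v l].
  move=> lt mt; have [cA [a1 a2 a3 a4]] := AP t; have [cB [b1 b2 b3 b4]] := BP t.
  rewrite lt in cA cB; have [hA _] := coupled_hill _ _ _ _ _ _ cA.
  have [hB1 hB2] := coupled_hill _ _ _ _ _ _ cB.
  have [_ Apos] := hill_growth r (fun=> mu t) p dp _ _ l l0 p0 (fun _ _ => mt)
    hp dp0 dpl hA a1 a2.
  have h0 : hill (fun x => r x + mu t) (cst 0) (cst 0).
    by move=> x; rewrite /= mulr0; split; exact: is_derive_cst.
  have [_ B0] := hill_unique _ _ _ _ _ _ (rmM (mu t)) hB1 h0 b1 b2 l.
  exists ((A t).1.1.2 l) => //; exists (B t).1.2, (B t).2; split=> //.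
  by rewrite /D B0 /= mulr0 subr0.
have D0 : D 0 < 0.
  have [| |e e0 [u [v [h u0 v0 ->]]]] := decoupled 0.
  - by rewrite /lam mul0r.
  - by rewrite /mu subr0 mul1r mul0r addr0.
  rewrite pmulr_rlt0//; move: h u0 v0.
  by rewrite /mu subr0 mul1r mul0r addr0; exact: crossing.
have D1 : 0 < D 1.
  have [| |e e0 [u [v [h u0 v0 ->]]]] := decoupled 1.
  - by rewrite /lam subrr mulr0.
  - by rewrite /mu subrr mul0r mul1r add0r.
  rewrite pmulr_rgt0//; move: h; rewrite /mu subrr mul0r mul1r add0r => h.
  have [||//] := hill_growth r (fun x => - s x + m2) p dp u v l l0 p0 _
    hp dp0 dpl _ u0 v0.
  - by move=> x _; have := sM x; rewrite /m2 ler_norml => /andP[_]; lra.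
  - by move=> x; have [? ?] := h x; split=> //; rewrite addrA.
have [|t] := @IVT R D 0 1 0 ler01 cD.
  by rewrite ge_min le_max (ltW D0) (ltW D1) orbT.
rewrite in_itv/= => /andP[t0 t1] Dt.
have {}t0 : 0 < t.
  rewrite lt_neqAle t0 andbT; apply/eqP => t00.
  by move: Dt D0; rewrite -t00 => ->; rewrite ltxx.
have {}t1 : t < 1.
  rewrite lt_neqAle t1 andbT; apply/eqP => t11.
  by move: Dt D1; rewrite t11 => ->; rewrite ltxx.
have [y [z [yz1 yz2 yz0]]] := singular_2x2 _ _ _ _ Dt.
have [cA [a1 a2 a3 a4]] := AP t; have [cB [b1 b2 b3 b4]] := BP t.
have cw := coupled_comb _ _ _ _ _ _ _ _ _ _ _ y z cA cB.
exists (lam t), (mu t); do 4 eexists; split; [| |exact: cw|split|].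
- by rewrite /lam mulr_gt0// subr_gt0.
- by rewrite /mu addr_gt0// mulr_gt0// subr_gt0.
- by rewrite a2 b2 !mulr0 addr0.
- by rewrite a4 b4 !mulr0 addr0.
- exact: yz1.
- exact: yz2.
- by rewrite /= a1 b1 a3 b3 !mulr0 !mulr1 addr0 add0r.
Qed.

End NeumannMode.

(** * Periodic functions and weak derivatives *)

Section Periodic.
Context {R : realType}.
Implicit Types (f df g p q r s u v w : R -> R) (L l c d x t m M a b : R).
Local Notation mu := (@lebesgue_measure R).

Lemma periodicz f L : periodic f L -> forall (n : int) x, f (x + L *~ n) = f x.
Proof.
move=> fL [n|n] x; first by rewrite -pmulrn (periodicn fL).
rewrite NegzE mulrNz -pmulrn.
by rewrite -[in RHS](subrK (L *+ n.+1) x) (periodicn fL).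
Qed.

Lemma periodic_bounded f L : 0 < L -> periodic f L -> continuous f ->
  exists M, forall x, `|f x| <= M.
Proof.
move=> L0 fL cf.
have [|c _ cmax] := @EVT_max R (fun x => `|f x|) 0 L (ltW L0).
  apply: continuous_subspaceT => x.
  by apply: continuous_comp; [exact: cf|exact: norm_continuous].
exists `|f c| => x; pose n := Num.floor (x / L).
rewrite -(periodicz _ _ fL (- n)) mulrNz.
apply: cmax; rewrite in_itv/=.
have := floor_itv (x / L); rewrite -/n.
rewrite ler_pdivlMr// ltr_pdivrMr// intrD mulrDl mul1r => /andP[n1 n2].
have -> : L *~ n = n%:~R * L by rewrite -mulrzl.
by apply/andP; split; lra.
Qed.

(** Reflection about [c] changes the sign of the derivative at [c]. *)
Lemma derive_symmetric f c d : is_derive c 1 f d ->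
  (forall x, f (c + x) = f (c - x)) -> d = 0.
Proof.
move=> fd fsym.
have d1 : is_derive (0 : R) 1 (fun x => f (c + x)) d.
  by apply: is_derive_translate; rewrite addr0.
have d2 : is_derive (0 : R) 1 (fun x => f (c + x)) (- d).
  under eq_fun do rewrite fsym.
  by apply: (is_derive_opp (fun x => f (c + x))); rewrite oppr0.
have := @derive_val _ _ _ _ _ _ _ d1.
by rewrite (@derive_val _ _ _ _ _ _ _ d2); lra.
Qed.

Lemma continuous_L2per L f : periodic f L -> continuous f -> L2per L f.
Proof.
move=> fL cf; split=> //; first exact: continuous_measurable_fun.
apply: (continuous_integrable_itv (fun x => f x ^+ 2)) => x.
under eq_fun do rewrite expr2.
by apply: continuousM; exact: cf.
Qed.

Lemma is_derive_LRcontinuous f df a b : (forall x, is_derive x 1 f (df x)) ->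
  derivable_oo_LRcontinuous f a b.
Proof.
move=> fdf.
have cf x : {for x, continuous f} := is_derive_continuous _ _ _ (fdf x).
split=> [x _||]; first by have [] := fdf x.
- exact: cvg_at_right_filter (cf a).
- exact: cvg_at_left_filter (cf b).
Qed.

(** Integration by parts over a period, whose boundary terms cancel. *)
Lemma classical_weak_deriv L f df : 0 < L -> periodic f L -> periodic df L ->
  (forall x, is_derive x 1 f (df x)) -> continuous df -> weak_deriv L f df.
Proof.
move=> L0 fL dfL fdf cdf.
have cf : continuous f by move=> x; exact: is_derive_continuous (fdf x).
split; [exact: continuous_L2per|exact: continuous_L2per|].
move=> psi [psiL psismooth].
have dpsi x : is_derive x 1 psi ((derive1 psi) x).
  by rewrite derive1E; apply: derivableP; exact: (psismooth 0%N).
have cdpsi : continuous (derive1 psi).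
  move=> x; have /derivableP := psismooth 1%N x; exact: is_derive_continuous.
rewrite /per_int (Rintegration_by_parts L0 (F := f) (f := df) (G := psi)).
- have := fL 0; have := psiL 0; rewrite add0r => -> ->.
  by rewrite subrr sub0r.
- by apply: continuous_subspaceT => x; exact: cdf.
- exact: is_derive_LRcontinuous fdf.
- by move=> x _; rewrite derive1E (@derive_val _ _ _ _ _ _ _ (fdf x)).
- by apply: continuous_subspaceT => x; exact: cdpsi.
- exact: is_derive_LRcontinuous dpsi.
- by [].
Qed.

Lemma not_ae_zero f (P : R -> Prop) : {for 0, continuous f} -> f 0 != 0 ->
  (forall x, P x -> f x = 0) -> ~ {ae mu, forall x, P x}.
Proof.
move=> cf f0 Pf [N [mN N0 sub]].
have f0' : 0 < `|f 0| by rewrite normr_gt0.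
have /cvgrPdist_lt/(_ _ f0')[d/= d0 df] := cf.
have : (mu [set` `]0%R, d[%R] <= mu N)%E.
  apply: le_measure; rewrite ?inE; [exact: measurable_itv|exact: mN|].
  move=> x; rewrite /= in_itv/= => /andP[x0 xd]; apply: sub => /= /Pf fx.
  have := df x; rewrite /ball_/= sub0r normrN gtr0_norm// => /(_ xd).
  by rewrite fx subr0 ltxx.
rewrite N0 lebesgue_measure_itv/= lte_fin d0 sube0 lee_fin leNgt d0//.
Qed.

End Periodic.

(** * Periodic modes and instability *)

Section Periodization.
Context {R : realType}.
Implicit Types (a b v w : R -> R) (L lam M x : R).

(** The solution is even about [0] and about [L / 2], and the composition of the
    two reflections is the translation by [L]. *)
Lemma coupled_neumann_periodic a b lam w1 v1 w2 v2 L M :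
  (forall x, `|a x| <= M) -> (forall x, `|b x| <= M) ->
  (forall x, a (- x) = a x) -> (forall x, b (- x) = b x) ->
  periodic a L -> periodic b L -> coupled a b lam w1 v1 w2 v2 ->
  v1 0 = 0 -> v2 0 = 0 -> v1 (L / 2) = 0 -> v2 (L / 2) = 0 ->
  [/\ periodic w1 L, periodic v1 L, periodic w2 L & periodic v2 L].
Proof.
move=> aM bM ae be aL bL cw v10 v20 v1l v2l.
have refl x : [/\ w1 (- x) = w1 x, - v1 (- x) = v1 x, w2 (- x) = w2 x &
                  - v2 (- x) = v2 x].
  have cw' := coupled_reflect _ _ _ _ _ _ _ cw.
  rewrite (_ : (fun x => a (- x)) = a) in cw'; last exact/funext.
  rewrite (_ : (fun x => b (- x)) = b) in cw'; last exact/funext.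
  apply: (coupled_unique _ _ _ _ _ _ _ _ _ _ _ M aM bM cw' cw).
  by rewrite oppr0 v10 v20 oppr0.
set l := L / 2 in v1l v2l; have Ll : L = l + l by rewrite /l; field.
have sym (f : R -> R) : periodic f L -> (forall x, f (- x) = f x) ->
    (fun x => f (l + - x)) = (fun x => f (l + x)).
  move=> fL fe; apply/funext => x; rewrite -fe opprB -[LHS]fL.
  by congr f; rewrite Ll; ring.
have refl_l x : [/\ w1 (l + - x) = w1 (l + x), - v1 (l + - x) = v1 (l + x),
    w2 (l + - x) = w2 (l + x) & - v2 (l + - x) = v2 (l + x)].
  have cwl := coupled_translate _ _ _ _ _ _ _ l cw.
  have cwl' := coupled_reflect _ _ _ _ _ _ _ cwl.
  rewrite (sym a)// (sym b)// in cwl'.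
  apply: (coupled_unique _ _ _ _ _ _ _ _ _ _ _ M _ _ cwl' cwl) => //.
  by rewrite oppr0 addr0 v1l v2l oppr0.
have xL x : x + L = l + (l + x) by rewrite Ll; ring.
have xl x : l + - (l + x) = - x by ring.
split=> x; rewrite xL; have [] := refl_l (l + x); rewrite xl;
  have [] := refl x => e1 e2 e3 e4 f1 f2 f3 f4.
- by rewrite -f1.
- by rewrite -f2.
- by rewrite -f3.
- by rewrite -f4.
Qed.

Lemma coupled_weak_deriv2 a b lam w1 v1 w2 v2 L : 0 < L ->
  continuous a -> continuous b -> periodic a L -> periodic b L ->
  coupled a b lam w1 v1 w2 v2 ->
  [/\ periodic w1 L, periodic v1 L, periodic w2 L & periodic v2 L] ->
  weak_deriv2 L w1 (fun x => a x * w1 x + lam * w2 x) /\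
  weak_deriv2 L w2 (fun x => b x * w2 x - lam * w1 x).
Proof.
move=> L0 ca cb aL bL cw [w1L v1L w2L v2L].
have cw1 : continuous w1.
  by move=> x; have [d _ _ _] := cw x; exact: is_derive_continuous d.
have cv1 : continuous v1.
  by move=> x; have [_ d _ _] := cw x; exact: is_derive_continuous d.
have cw2 : continuous w2.
  by move=> x; have [_ _ d _] := cw x; exact: is_derive_continuous d.
have cv2 : continuous v2.
  by move=> x; have [_ _ _ d] := cw x; exact: is_derive_continuous d.
have cM (f g : R -> R) : continuous f -> continuous g ->
    continuous (fun x => f x * g x).
  by move=> cf cg x; apply: continuousM; [exact: cf|exact: cg].
split; [exists v1|exists v2]; apply: classical_weak_deriv => //.
- by move=> x; have [] := cw x.
- by move=> x; rewrite aL w1L w2L.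
- by move=> x; have [] := cw x.
- move=> x; apply: cvgD; first exact: cM.
  by apply: (cM (cst lam) w2) => //; exact: cst_continuous.
- by move=> x; have [] := cw x.
- by move=> x; rewrite bL w1L w2L.
- by move=> x; have [] := cw x.
- move=> x; apply: cvgB; first exact: cM.
  by apply: (cM (cst lam) w1) => //; exact: cst_continuous.
Qed.

End Periodization.

Theorem theorem1p1 (R : realType) (L alpha omega : R) (phi : R -> R)
  (L_gt0 : 0 < L) (alpha_gt0 : 0 < alpha) (omega_gt0 : 0 < omega)
  (phi_even : forall x, phi (- x) = phi x)
  (phi_gt0 : forall x, 0 < phi x)
  (phi_period : minimal_period phi L)
  (phi_sol : stationary alpha omega phi)
  (phi_min : from_minimization L alpha omega phi) :
  (exists (lambda kappa : R) (w : (R -> R) * (R -> R)),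
     [/\ 0 < lambda, 0 < kappa, HH2per L w, ~ ae_eq2 w 0 &
         S_graph L alpha omega phi kappa w (lambda *: J w)]) /\
  transversally_unstable L alpha omega phi.
Proof.
have [_ phiL _] := phi_period.
pose dphi : R -> R := derive1 phi; pose q x := phi x `^ alpha.
have phid (x : R) : is_derive x 1 phi (dphi x).
  by have [d1 _ _] := phi_sol x; rewrite /dphi derive1E; exact: derivableP.
have hphi : hill (fun x => omega - q x) phi dphi.
  move=> x; split=> //; have [_ d2 eqx] := phi_sol x.
  have -> : (omega - q x) * phi x = derive1 dphi x.
    move: eqx; rewrite (gtr0_norm (phi_gt0 x)) -/(q x) /dphi.
    by rewrite derive1nS derive1n1; lra.
  by rewrite derive1E; exact: derivableP.
have dphi0 : dphi 0 = 0.
  by apply: (derive_symmetric phi 0) => // x; rewrite add0r sub0r phi_even.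
pose l := L / 2; have l0 : 0 < l by rewrite divr_gt0.
(* [phi] is symmetric about [l], being even and [2 l]-periodic. *)
have dphil : dphi l = 0.
  apply: (derive_symmetric phi l) => // x; rewrite -phi_even -phiL.
  by congr phi; rewrite /l; field.
have q0 x : 0 < q x by exact: powR_gt0.
have cq : continuous q.
  move=> x; have dq := is_derive1_powR alpha (phi_gt0 x).
  exact: is_derive_continuous (is_derive1_comp dq (phid x)).
have qe x : q (- x) = q x by rewrite /q phi_even.
have qL : periodic q L by move=> x; rewrite /q phiL.
pose r x := omega - q x; pose s x := alpha * q x.
have cr : continuous r by move=> x; apply: cvgB; [exact: cvg_cst|exact: cq].
have cs : continuous s by move=> x; apply: cvgM; [exact: cvg_cst|exact: cq].
have re x : r (- x) = r x by rewrite /r qe.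
have se x : s (- x) = s x by rewrite /s qe.
have rL : periodic r L by move=> x; rewrite /r qL.
have sL : periodic s L by move=> x; rewrite /s qL.
have [Mr rMr] := periodic_bounded r L L_gt0 rL cr.
have [Ms sMs] := periodic_bounded s L L_gt0 sL cs.
have rM x : `|r x| <= Num.max Mr Ms by rewrite le_max rMr.
have sM x : `|s x| <= Num.max Mr Ms by rewrite le_max sMs orbT.
have s0 x : 0 < s x by rewrite /s mulr_gt0.
have [lam [m [w1 [v1 [w2 [v2 [lam0 m0 cw [v10 v20 v1l v2l] wn0]]]]]]] :=
  coupled_neumann_exists r s phi dphi l _ l0 cr cs rM sM s0 phi_gt0 hphi
    dphi0 dphil.
pose a x := r x + m; pose b x := r x - s x + m.
have ca : continuous a by move=> x; apply: cvgD; [exact: cr|exact: cvg_cst].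
have cb : continuous b.
  by move=> x; apply: cvgD; [apply: cvgB; [exact: cr|exact: cs]|exact: cvg_cst].
have aL : periodic a L by move=> x; rewrite /a rL.
have bL : periodic b L by move=> x; rewrite /b rL sL.
have aM x : `|a x| <= Mr + Ms + m.
  rewrite (le_trans (ler_normD _ _))// (gtr0_norm m0) lerD2r.
  by rewrite (le_trans (rMr x))// lerDl (le_trans _ (sMs 0)).
have bM x : `|b x| <= Mr + Ms + m.
  rewrite (le_trans (ler_normD _ _))// (gtr0_norm m0) lerD2r.
  by rewrite (le_trans (ler_normB _ _))// lerD.
have wL := coupled_neumann_periodic a b lam w1 v1 w2 v2 L _ aM bM
  (fun x => congr1 (fun y => y + m) (re x)) _ aL bL cw v10 v20 v1l v2l.
have {}wL : [/\ periodic w1 L, periodic v1 L, periodic w2 L & periodic v2 L].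
  by apply: wL => x; rewrite /b re se.
have [W1 W2] := coupled_weak_deriv2 a b lam w1 v1 w2 v2 L L_gt0 ca cb aL bL cw wL.
pose w := (w1, w2).
have kk : Num.sqrt m ^+ 2 = m by rewrite sqr_sqrtr// ltW.
have k0 : 0 < Num.sqrt m by rewrite sqrtr_gt0.
have wH : HH2per L w by split; [exists (fun x => a x * w1 x + lam * w2 x)|
  exists (fun x => b x * w2 x - lam * w1 x)].
have wne : ~ ae_eq2 w 0.
  move=> w0; have cw1 : {for 0, continuous w1}.
    by have [d _ _ _] := cw 0; exact: is_derive_continuous d.
  have cw2 : {for 0, continuous w2}.
    by have [_ _ d _] := cw 0; exact: is_derive_continuous d.
  move: wn0 => /orP[w10|w20].
    by apply: (not_ae_zero w1 _ cw1 w10) w0 => x [].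
  by apply: (not_ae_zero w2 _ cw2 w20) w0 => x [].
have wS : S_graph L alpha omega phi (Num.sqrt m) w (lam *: J w).
  exists ((fun x => a x * w1 x + lam * w2 x), (fun x => b x * w2 x - lam * w1 x)).
    by split.
  apply: aeW => x /=; rewrite kk /calL1 /calL2 (gtr0_norm (phi_gt0 x)) -/(q x).
  rewrite /a /b /r /s; split.
    transitivity (lam * (- w2 x)); last by [].
    by ring.
  transitivity (lam * w1 x); last by [].
  by ring.
split; first by exists lam, (Num.sqrt m), w.
(* As [lam] is real, equal real and imaginary parts solve both equations. *)
exists (Num.sqrt m), (Complex lam 0), w, w.
rewrite /= scale0r subr0 addr0; split=> //.
by move=> [].
Qed.
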